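(* Let $(\Omega,\mathcal{F},\mathbb{P})$ be a nonatomic probability space and let $(\Phi,\Psi)$ be an Orlicz pair as in the context. Let $\rho:L^\Phi\to(-\infty,\infty]$ be a proper, quasiconvex (in particular, any convex), law-invariant functional. Then the following statements are equivalent: (1) $\rho$ is $\sigma(L^\Phi,L^\infty)$ lower semicontinuous; (2) $\rho$ is $\sigma(L^\Phi,H^\Psi)$ lower semicontinuous; (3) $\rho$ is $\sigma(L^\Phi,L^\Psi)$ lower semicontinuous; (4) $\rho$ has the Fatou property.
   Context: $(\Omega,\mathcal{F},\mathbb{P})$ is a nonatomic probability space; random variables are identified up to a.s. equality. An Orlicz function is a convex, increasing $\Phi:[0,\infty)\to[0,\infty)$ with $\Phi(0)=0$; its conjugate is $\Psi(s)=\sup_{t\ge0}(ts-\Phi(t))$. Standing assumption: $\Phi(t)>0$ for $t>0$ and $\lim_{t\to\infty}\Phi(t)/t=\infty$ (so $\Psi$ is also a finite Orlicz function). $L^\Phi$ is the space of random variables $X$ with $\|X\|_\Phi:=\inf\{\lambda>0:\mathbb{E}[\Phi(|X|/\lambda)]\le 1\}<\infty$; the Orlicz heart is $H^\Phi=\{X\in L^\Phi:\mathbb{E}[\Phi(|X|/\lambda)]<\infty \text{ for all }\lambda>0\}$; $L^\Psi$ and $H^\Psi$ are defined analogously. One has $L^\infty\subset H^\Phi\subset L^\Phi\subset L^1$, and the weak topologies $\sigma(L^\Phi,\cdot)$ refer to the pairing $\langle X,Y\rangle=\mathbb{E}[XY]$. A functional is proper if it is not identically $\infty$; quasiconvex if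 each sublevel set $\{\rho\le\lambda\}$, $\lambda\in\mathbb{R}$, is convex; law-invariant if $\rho(X)=\rho(Y)$ whenever $X,Y$ have the same law. $\rho$ has the Fatou property if whenever $X_n\to X$ a.s. and $|X_n|\le Y$ for some $Y\in L^\Phi$ and all $n$, then $\rho(X)\le\liminf_n\rho(X_n)$. *)

(* Defs.v *)
From HB Require Import structures.
From mathcomp Require Import all_boot all_order all_algebra.
From mathcomp Require Import all_classical all_reals all_analysis.
Set Implicit Arguments. Unset Strict Implicit. Unset Printing Implicit Defensive.
Import Order.TTheory GRing.Theory Num.Theory numFieldNormedType.Exports.
Local Open Scope classical_set_scope.
Local Open Scope ring_scope.

Section OrliczDefs.
Context {d : measure_display} {T : measurableType d} {R : realType}.

Definition nonatomic (P : probability T R) : Prop :=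
  forall A, measurable A -> (0 < P A)%E ->
    exists B, [/\ measurable B, B `<=` A, (0 < P B)%E & (P B < P A)%E].

(* Orlicz function on [0,oo) (values off [0,oo) are irrelevant) *)
Definition orlicz_function (Phi : R -> R) : Prop :=
  [/\ Phi 0 = 0,
      (forall s t, 0 <= s -> s <= t -> Phi s <= Phi t),
      (forall s t l, 0 <= s -> 0 <= t -> 0 <= l -> l <= 1 ->
         Phi (l * s + (1 - l) * t) <= l * Phi s + (1 - l) * Phi t),
      (forall t, 0 < t -> 0 < Phi t) &
      ((fun t => Phi t / t) @ +oo --> +oo)%classic].

Definition conjugate (Phi : R -> R) (s : R) : R :=
  sup [set t * s - Phi t | t in [set t : R | 0 <= t]].

Definition modular (P : probability T R) (Phi : R -> R) (X : T -> R) (l : R)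
  : \bar R := (\int[P]_x (Phi (`|X x| / l))%:E)%E.

(* X in L^Phi  iff  ||X||_Phi < oo  iff  E[Phi(|X|/l)] <= 1 for some l > 0 *)
Definition LOrlicz (P : probability T R) (Phi : R -> R) : set (T -> R) :=
  [set X : T -> R | measurable_fun setT X /\
           exists l, 0 < l /\ (modular P Phi X l <= 1)%E].

Definition HOrlicz (P : probability T R) (Phi : R -> R) : set (T -> R) :=
  [set X : T -> R | LOrlicz P Phi X /\
           forall l, 0 < l -> (modular P Phi X l < +oo)%E].

Definition Linfty (P : probability T R) : set (T -> R) :=
  [set Y : T -> R | measurable_fun setT Y /\
           exists M : R, {ae P, forall x, `|Y x| <= M}].

Definition pairing (P : probability T R) (X Y : T -> R) : R :=
  \int[P]_(x in setT) (X x * Y x).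

(* lower semicontinuity of rho on L^Phi for the weak topology
   sigma(L^Phi, E), whose basic neighbourhoods of X are
   {Z in L^Phi : |<Z - X, Y_i>| < eps, i < n}, Y_i in E, eps > 0 *)
Definition weak_lsc (P : probability T R) (Phi : R -> R) (E : set (T -> R))
  (rho : (T -> R) -> \bar R) : Prop :=
  forall X, LOrlicz P Phi X -> forall l : R, (l%:E < rho X)%E ->
    exists (n : nat) (Ys : nat -> T -> R) (eps : R),
      [/\ 0 < eps, (forall i, (i < n)%N -> E (Ys i)) &
          forall Z, LOrlicz P Phi Z ->
            (forall i, (i < n)%N -> `|pairing P (Z \- X) (Ys i)| < eps) ->
            (l%:E < rho Z)%E].

Definition proper_on (S : set (T -> R)) (rho : (T -> R) -> \bar R) : Prop :=
  exists X, S X /\ (rho X < +oo)%E.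

Definition quasiconvex_on (S : set (T -> R)) (rho : (T -> R) -> \bar R)
  : Prop :=
  forall X Y (t : R), S X -> S Y -> 0 <= t -> t <= 1 ->
    (rho (fun x => t * X x + (1 - t) * Y x)%R <= Order.max (rho X) (rho Y))%E.

Definition same_law (P : probability T R) (X Y : T -> R) : Prop :=
  forall B : set R, measurable B -> P (X @^-1` B) = P (Y @^-1` B).

Definition law_invariant_on (P : probability T R) (S : set (T -> R))
  (rho : (T -> R) -> \bar R) : Prop :=
  forall X Y, S X -> S Y -> same_law P X Y -> rho X = rho Y.

Definition fatou_property (P : probability T R) (Phi : R -> R)
  (rho : (T -> R) -> \bar R) : Prop :=
  forall (Xn : nat -> T -> R) (X Y : T -> R),
    (forall n, LOrlicz P Phi (Xn n)) -> LOrlicz P Phi X -> LOrlicz P Phi Y ->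
    {ae P, forall x, (fun n => Xn n x) @ \oo --> X x} ->
    (forall n, {ae P, forall x, `|Xn n x| <= Y x}) ->
    (rho X <= limn_einf (fun n => rho (Xn n)))%E.

End OrliczDefs.

(* Main.v *)
Require Import Defs.
From HB Require Import structures.
From mathcomp Require Import all_boot all_order all_algebra.
From mathcomp Require Import all_classical all_reals all_analysis.
From mathcomp Require Import measurable_realfun ring lra.
Set Implicit Arguments. Unset Strict Implicit. Unset Printing Implicit Defensive.
Import Order.TTheory GRing.Theory Num.Theory numFieldNormedType.Exports.
Local Open Scope classical_set_scope.
Local Open Scope ring_scope.

(* The implications (1) => (2) => (3) hold because L^oo, H^Psi, L^Psi increase, and
   (3) => (4) is dominated convergence, Young's inequality making X * Y integrable.
   For (4) => (1), the sublevel set C = {rho <= l} is convex and law-invariant. By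
   the Fatou property it is closed for modular convergence, since a sequence
   converging fast enough in modular converges a.s. and is dominated in L^Phi.
   The key point is that C is stable under averaging over a cell A: nonatomicity
   provides a uniform variable on A, hence law-preserving cyclic rearrangements of X
   on A, whose averages converge in modular to the mean of X on A. So C contains
   E[Z|pi] for every Z in C and every finite partition pi. If X is not separated
   from C by a weak neighbourhood, then E[X|pi] is approximated by E[Z|pi] with Z
   in C, and X is approximated in modular by E[X|pi], with pi made of the level sets
   of X. *)

(** * Orlicz modulars *)

(** The obstacle is growth: when [Phi] grows too fast, bounded variables are not norm dense in
    [LOrlicz P Phi], and the tails of [X] need not be small in norm. At one fixed scale [l] with
    finite modular they are small. The argument therefore works with the modular at a single scale,
    which is enlarged by a factor 2 each time a difference is split in two. The Fatou property suits
    this notion, since it asks for one dominating element of the space and not for norm convergence.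
    A weak neighbourhood is used only through finitely many numbers, the integrals over cells. The
    partition, hence the indicators that serve as test functions, is built from [X], the scale and
    the tolerance before [Z] is known. No bound on [Z] is available, so only its cell means can be
    compared with [X]; this is why stability of [C] under averaging over a cell is the crux. *)

Section OrliczSpace.
Context {d : measure_display} {T : measurableType d} {R : realType}.
Variables (P : probability T R) (Phi : R -> R).
Hypothesis orlPhi : orlicz_function Phi.

Lemma orlicz_homo s t : 0 <= s -> s <= t -> Phi s <= Phi t.
Proof. by case: orlPhi => _ + _ _ _; exact. Qed.

Lemma orlicz_ge0 t : 0 <= t -> 0 <= Phi t.
Proof. by move=> t0; case: orlPhi => P0 _ _ _ _; rewrite -P0 orlicz_homo. Qed.

Lemma orlicz_gt0 t : 0 < t -> 0 < Phi t.
Proof. by case: orlPhi => _ _ _ + _; exact. Qed.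

Lemma orlicz_scale c t : 0 <= t -> 0 <= c -> c <= 1 -> Phi (c * t) <= c * Phi t.
Proof.
case: orlPhi => P0 _ conv _ _ t0 c0 c1.
by have := conv t 0 c t0 (lexx 0) c0 c1; rewrite mulr0 addr0 P0 mulr0 addr0.
Qed.

Lemma orlicz_mid s t : 0 <= s -> 0 <= t -> Phi ((s + t) / 2) <= (Phi s + Phi t) / 2.
Proof.
case: orlPhi => _ _ conv _ _ s0 t0.
have := conv s t 2^-1 s0 t0.
have -> : 2^-1 * s + (1 - 2^-1) * t = (s + t) / 2 by field.
have -> : 2^-1 * Phi s + (1 - 2^-1) * Phi t = (Phi s + Phi t) / 2 by field.
by apply; lra.
Qed.

Lemma measurable_orlicz (X : T -> R) (l : R) D : measurable D -> 0 < l -> measurable_fun D X ->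
  measurable_fun D (EFin \o (fun x => Phi (`|X x| / l))).
Proof.
move=> mD l0 mX; apply/measurable_EFinP.
(* [Phi] is arbitrary on negative numbers; precomposing with [Num.max 0] gives a function that is
   monotone on the whole line, hence Borel. *)
rewrite [X in measurable_fun _ X](_ : _ = (fun t => Phi (Num.max 0 t)) \o (fun x => `|X x| / l)); last first.
  by apply/funext => x /=; rewrite max_r// divr_ge0// ltW.
apply: measurableT_comp.
  apply: nondecreasing_measurable => // s t st.
  apply: orlicz_homo; first by rewrite le_max lexx.
  by rewrite ge_max !le_max lexx st orbT.
apply: measurable_funM => //.
exact: measurableT_comp.
Qed.

Lemma modular_ge0 X l : 0 < l -> (0 <= modular P Phi X l)%E.
Proof.
by move=> l0; apply: integral_ge0 => x _; rewrite lee_fin orlicz_ge0// divr_ge0// ltW.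
Qed.

Lemma le_modular (X Y : T -> R) (l : R) : 0 < l -> measurable_fun setT X -> measurable_fun setT Y ->
  {ae P, forall x, `|X x| <= `|Y x|} -> (modular P Phi X l <= modular P Phi Y l)%E.
Proof.
move=> l0 mX mY XY; apply: ae_ge0_le_integral => //.
- by move=> x _; rewrite lee_fin orlicz_ge0// divr_ge0// ltW.
- exact: measurable_orlicz.
- by move=> x _; rewrite lee_fin orlicz_ge0// divr_ge0// ltW.
- exact: measurable_orlicz.
apply: filterS XY => x XY _; rewrite lee_fin orlicz_homo//.
  by rewrite divr_ge0// ltW.
by rewrite ler_pM2r// invr_gt0.
Qed.

(** Doubling the scale turns the sum into a midpoint, where convexity applies. The factor 1/2 that
    convexity yields on the right is dropped. *)
Lemma modularD (X Y : T -> R) (l : R) : 0 < l -> measurable_fun setT X -> measurable_fun setT Y ->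
  (modular P Phi (X \+ Y)%R (l * 2)%R <= modular P Phi X l + modular P Phi Y l)%E.
Proof.
move=> l0 mX mY.
have l20 : 0 < l * 2 by rewrite mulr_gt0.
have pos (Z : T -> R) x : 0 <= `|Z x| / l by rewrite divr_ge0// ltW.
rewrite /modular -ge0_integralD//; first last.
- exact: measurable_orlicz.
- by move=> x _; rewrite lee_fin orlicz_ge0.
- exact: measurable_orlicz.
- by move=> x _; rewrite lee_fin orlicz_ge0.
apply: ge0_le_integral => //.
- by move=> x _; rewrite lee_fin orlicz_ge0// divr_ge0// ltW.
- by apply: measurable_orlicz => //; exact: measurable_funD.
- by apply: emeasurable_funD; exact: measurable_orlicz.
move=> x _; rewrite -EFinD lee_fin.
apply: (@le_trans _ _ (Phi ((`|X x| / l + `|Y x| / l) / 2))).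
  apply: orlicz_homo; first by rewrite divr_ge0// ltW.
  have -> : (`|X x| / l + `|Y x| / l) / 2 = (`|X x| + `|Y x|) / (l * 2).
    by field; rewrite gt_eqF.
  by rewrite ler_pM2r ?invr_gt0// ler_normD.
apply: (le_trans (orlicz_mid (pos X x) (pos Y x))).
have := orlicz_ge0 (pos X x); have := orlicz_ge0 (pos Y x); lra.
Qed.

Lemma modular_scale (X : T -> R) (l c : R) : 0 < l -> 1 <= c -> measurable_fun setT X ->
  (modular P Phi X (c * l)%R <= (c^-1)%:E * modular P Phi X l)%E.
Proof.
move=> l0 c1 mX; have c0 : 0 < c by rewrite (lt_le_trans _ c1).
have pos (Z : T -> R) x : 0 <= `|Z x| / l by rewrite divr_ge0// ltW.
rewrite /modular -ge0_integralZl//; last 3 first.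
- exact: measurable_orlicz.
- by move=> x _; rewrite lee_fin orlicz_ge0.
- by rewrite lee_fin invr_ge0 ltW.
apply: ge0_le_integral => //.
- by move=> x _; rewrite lee_fin orlicz_ge0// divr_ge0// mulr_ge0// ltW.
- by apply: measurable_orlicz => //; exact: mulr_gt0.
- by apply: measurable_funeM; exact: measurable_orlicz.
move=> x _; rewrite -EFinM lee_fin.
have -> : `|X x| / (c * l) = c^-1 * (`|X x| / l) by rewrite invfM mulrCA.
by apply: orlicz_scale => //; [rewrite invr_ge0 ltW|rewrite invf_le1].
Qed.

(** Convexity makes the modular decay at least linearly in the inverse scale: if it is [r] at scale
    [l], it is at most [r / (1 + r)] at scale [(1 + r) * l]. *)
Lemma modular_LOrlicz (X : T -> R) (l : R) : measurable_fun setT X -> 0 < l ->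
  (modular P Phi X l < +oo)%E -> LOrlicz P Phi X.
Proof.
move=> mX l0 Xl; split => //.
have : modular P Phi X l \is a fin_num by rewrite ge0_fin_numE// modular_ge0.
move=> /fineK Xfin; set r := fine _ in Xfin.
have r0 : 0 <= r by rewrite -lee_fin Xfin modular_ge0.
have r1 : 0 < 1 + r by rewrite ltr_pwDl.
exists ((1 + r) * l); split; first by rewrite mulr_gt0.
apply: (le_trans (modular_scale l0 _ mX)); first by rewrite lerDl.
by rewrite -Xfin -EFinM lee_fin mulrC ler_pdivrMr// mul1r lerDr.
Qed.

Lemma LOrlicz_measurable (X : T -> R) : LOrlicz P Phi X -> measurable_fun setT X.
Proof. by case. Qed.

Lemma LOrliczD (X Y : T -> R) : LOrlicz P Phi X -> LOrlicz P Phi Y -> LOrlicz P Phi (X \+ Y).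
Proof.
move=> [mX [l [l0 Xl]]] [mY [k [k0 Yk]]].
have lk : 0 < l + k by exact: addr_gt0.
apply: (@modular_LOrlicz _ ((l + k) * 2)).
- exact: measurable_funD.
- by rewrite mulr_gt0.
apply: (le_lt_trans (modularD lk mX mY)).
have le1 (Z : T -> R) (j i : R) : measurable_fun setT Z -> 0 < j -> 0 < i -> (modular P Phi Z j <= 1)%E ->
    (modular P Phi Z (j + i)%R <= 1)%E.
  move=> mZ j0 i0; apply: le_trans.
  apply: ge0_le_integral => //.
  - by move=> x _; rewrite lee_fin orlicz_ge0// divr_ge0// addr_ge0// ltW.
  - by apply: measurable_orlicz => //; exact: addr_gt0.
  - exact: measurable_orlicz.
  move=> x _; rewrite lee_fin orlicz_homo//; first by rewrite divr_ge0// addr_ge0// ltW.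
  by apply: ler_wpM2l => //; rewrite lef_pV2 ?posrE ?addr_gt0// lerDl ltW.
apply: (@le_lt_trans _ _ (1 + 1)%E); last by rewrite -EFinD ltry.
by apply: leeD; [|rewrite addrC]; exact: le1.
Qed.

Lemma LOrliczZ c (X : T -> R) : LOrlicz P Phi X -> LOrlicz P Phi (fun x => c * X x).
Proof.
move=> [mX [l [l0 Xl]]].
split; first exact: measurable_funM.
exists ((1 + `|c|) * l); split; first by rewrite mulr_gt0// ltr_pwDl.
apply: le_trans Xl.
apply: ge0_le_integral => //.
- by move=> x _; rewrite lee_fin orlicz_ge0// divr_ge0// mulr_ge0// ltW.
- by apply: measurable_orlicz => //; [rewrite mulr_gt0// ltr_pwDl|exact: measurable_funM].
- exact: measurable_orlicz.
move=> x _; rewrite lee_fin orlicz_homo//; first by rewrite divr_ge0// mulr_ge0// ltW.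
rewrite ler_pdivrMr; last by rewrite mulr_gt0// ltr_pwDl.
have -> : `|X x| / l * ((1 + `|c|) * l) = `|X x| * (1 + `|c|) by field; rewrite gt_eqF.
by rewrite normrM mulrC ler_wpM2l// lerDr.
Qed.

Lemma le_LOrlicz (X Y : T -> R) : measurable_fun setT X -> LOrlicz P Phi Y ->
  {ae P, forall x, `|X x| <= `|Y x|} -> LOrlicz P Phi X.
Proof.
move=> mX [mY [l [l0 Yl]]] XY; split => //; exists l; split => //.
by apply: le_trans Yl; exact: le_modular.
Qed.

Lemma LOrlicz_cst c : LOrlicz P Phi (cst c).
Proof.
apply: (@modular_LOrlicz _ 1) => //.
rewrite /modular/= integral_cst//. by rewrite ltey_eq fin_numM// fin_num_measure.
Qed.

Lemma modular_integrable (X : T -> R) (l : R) : 0 < l -> measurable_fun setT X -> (modular P Phi X l < +oo)%E ->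
  P.-integrable setT (EFin \o (fun x => Phi (`|X x| / l))).
Proof.
move=> l0 mX Xl; apply/integrableP; split; first exact: measurable_orlicz.
rewrite (eq_integral (fun x => (Phi (`|X x| / l))%:E))// => x _.
by rewrite gee0_abs// lee_fin orlicz_ge0// divr_ge0// ltW.
Qed.

(** For [t >= 1] convexity gives [t * Phi 1 <= Phi t], so [t <= 1 + Phi t / Phi 1] for every
    [t >= 0]; apply this to [|X| / l]. *)
Lemma LOrlicz_integrable (X : T -> R) : LOrlicz P Phi X -> P.-integrable setT (EFin \o X).
Proof.
move=> [mX [l [l0 Xl]]].
have iX := modular_integrable l0 mX (le_lt_trans Xl (ltry 1)).
have P1 : 0 < Phi 1 by exact: orlicz_gt0.
apply: (@le_integrable _ _ _ P _ measurableT _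
  (fun x => (l * (1 + (Phi 1)^-1 * Phi (`|X x| / l)))%:E)).
- exact/measurable_EFinP.
- move=> x _ /=; rewrite lee_fin [leRHS]ger0_norm; last first.
    rewrite mulr_ge0 ?addr_ge0 ?mulr_ge0 ?invr_ge0 ?orlicz_ge0 ?divr_ge0//; exact: ltW.
  set t := `|X x| / l.
  have t0 : 0 <= t by rewrite divr_ge0// ltW.
  have -> : `|X x| = l * t by rewrite mulrC divfK// gt_eqF.
  rewrite ler_pM2l//.
  have [t1|t1] := leP t 1.
    by rewrite (le_trans t1)// lerDl mulr_ge0 ?orlicz_ge0// invr_ge0 ltW.
  rewrite -[leLHS]add0r lerD// mulrC ler_pdivlMr//.
  have tp : 0 < t by rewrite (lt_trans _ t1).
  have := @orlicz_scale t^-1 t t0; rewrite mulVf ?gt_eqF//.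
  rewrite invr_ge0 invf_le1// => /(_ t0 (ltW t1)).
  by rewrite mulrC ler_pdivlMr// mulrC.
- under eq_fun do rewrite EFinM EFinD EFinM.
  apply: integrableZl => //; apply: integrableD => //.
    exact: finite_measure_integrable_cst.
  exact: integrableZl.
Qed.

End OrliczSpace.

(** * Uniform variables on nonatomic spaces *)

Section Nonatomic.
Context {d : measure_display} {T : measurableType d} {R : realType}.
Variable P : probability T R.

(** Inclusion is deduced from comparison of measures, so members of equal measure coincide and the
    family can be explored through real numbers. *)
Definition measure_chain (D : set (set T)) : Prop :=
  (forall C, D C -> measurable C) /\
  (forall C E, D C -> D E -> (P C <= P E)%E -> C `<=` E).

Lemma measure_chainU (D : set (set T)) C E : measure_chain D -> D C -> D E -> D (C `|` E).
Proof.
move=> [_ DD] DC DE; have [CE|/ltW EC] := leP (P C) (P E).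
  by rewrite (setUidr (DD _ _ DC DE CE)).
by rewrite (setUidl (DD _ _ DE DC EC)).
Qed.

(** The union may be uncountable. If some member contains all others, it is the union. Otherwise no
    member attains the supremum of the measures, so a sequence of members approaching that supremum
    eventually contains each member, and continuity from below applies. *)
Lemma measure_chain_bigcup (D : set (set T)) : measure_chain D ->
  measurable (\bigcup_(C in D) C) /\
  forall q, (0 <= q)%E -> (forall C, D C -> (P C <= q)%E) -> (P (\bigcup_(C in D) C) <= q)%E.
Proof.
move=> Dch; have [mD DD] := Dch.
have [[C0 DC0 maxC]|nomax] := pselect (exists2 C0, D C0 & forall C, D C -> C `<=` C0).
  have -> : \bigcup_(C in D) C = C0.
    by apply/seteqP; split => [x [C DC Cx]|x C0x]; [exact: (maxC C)|exists C0].
  by split; [exact: mD|move=> q _; exact].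
have {}nomax C : D C -> exists2 E, D E & (P C < P E)%E.
  move=> DC; apply: contrapT => h; apply: nomax; exists C => // E DE.
  apply: DD => //; rewrite leNgt; apply/negP => CE; apply: h; by exists E.
have [->|/set0P[C1 DC1]] := eqVneq D set0.
  by rewrite bigcup_set0; split => // q q0 _; rewrite measure0.
pose S := [set fine (P C) | C in D].
have fD C : D C -> P C \is a fin_num by move=> DC; apply: fin_num_measure; exact: mD.
have supS : has_sup S.
  split; first by exists (fine (P C1)), C1.
  exists 1 => _ [C DC <-]; rewrite -lee_fin fineK ?fD//.
  by apply: probability_le1; exact: mD.
have /choice[F FP] : forall n, exists C, D C /\ sup S - n.+1%:R^-1 < fine (P C).
  move=> n; have [|_ [C DC <-] lt] := @sup_adherent _ S n.+1%:R^-1 _ supS.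
    by rewrite invr_gt0.
  by exists C.
have FE : \bigcup_(C in D) C = \bigcup_n F n.
  apply/seteqP; split => [x [C DC Cx]|x [n _ Fx]]; last by exists (F n) => //; case: (FP n).
  have [E DE CE] := nomax C DC.
  have {}CE : fine (P C) < sup S.
    apply: (@lt_le_trans _ _ (fine (P E))); first by rewrite fine_lt ?fD.
    by apply: ub_le_sup; [case: supS|exists E].
  have [n nCE] : exists n, n.+1%:R^-1 < sup S - fine (P C).
    have cpos : 0 < sup S - fine (P C) by rewrite subr_gt0.
    have [N _ /(_ N (leqnn N))] := near_infty_natSinv_lt (PosNum cpos).
    by exists N.
  exists n => //; have [DF Fn] := FP n; apply: (DD _ _ DC DF) => //.
  by rewrite -(fineK (fD _ DC)) -(fineK (fD _ DF)) lee_fin; apply/ltW/(lt_trans _ Fn); rewrite ltrBrDr addrC -ltrBrDr.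
rewrite FE; have mF n : measurable (F n) by apply: mD; case: (FP n).
split; first exact: bigcupT_measurable.
move=> q q0 Dq.
pose G n := \big[setU/set0]_(i < n) F i.
have GD n : D (G n.+1).
  elim: n => [|n IH]; first by rewrite /G big_ord1; case: (FP 0%N).
  by rewrite /G big_ord_recr/=; apply: measure_chainU => //; case: (FP n.+1).
have mG n : measurable (G n) by apply: bigsetU_measurable.
rewrite -bigcup_bigsetU_bigcup.
have GE : \bigcup_k \big[setU/set0]_(i < k.+1) F i = \bigcup_n G n.
  apply/seteqP; split => x [n _ Gx]; first by exists n.+1.
  case: n Gx => [|n Gx]; last by exists n.
  by rewrite /G big_ord0.
rewrite GE; have cv : P (G n) @[n --> \oo] --> P (\bigcup_n G n).
  apply: nondecreasing_cvg_mu => //; first exact: bigcupT_measurable.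
  by move=> m n mn; apply/subsetPset; exact: subset_bigsetU.
rewrite -(cvg_lim _ cv)//; apply: lime_le; first by apply/cvg_ex; exists (P (\bigcup_n G n)).
by apply: nearW => -[|n]; [rewrite /G big_ord0 measure0|exact: Dq].
Qed.

Hypothesis naP : nonatomic P.

(* Zorn gives a maximal chain; requiring that null sets are empty and that sets of
   full measure are equal to [A] forces [set0] and [A] to belong to it. A value [t]
   missed by [P] on the chain would leave a gap between the union [Lo] of the
   smaller sets and the intersection [M] of the larger ones, where nonatomicity
   (or [Lo] itself) provides one more set. *)
Lemma nonatomic_chain (A : set T) : measurable A -> (0 < P A)%E ->
  exists E : set (set T), [/\ measure_chain E, (forall C, E C -> C `<=` A) &
    forall t : R, 0 <= t -> (t%:E <= P A)%E -> exists2 C, E C & P C = t%:E].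
Proof.
move=> mA A0.
pose Q (D : set (set T)) := measure_chain D /\ forall C, D C ->
  [/\ C `<=` A, (P C = 0 -> C = set0)%E & (P C = P A -> C = A)].
have [F FQ tF|E [[[mE EE] QE] maxE]] := @Zorn_bigcup _ Q.
  split; first split.
  - by move=> C [D FD DC]; have [[+ _] _] := FQ _ FD; exact.
  - move=> C C' [D FD DC] [D' FD' DC'].
    have [DD'|D'D] := tF _ _ FD FD'.
      by have [[_ +] _] := FQ _ FD'; apply => //; exact: DD'.
    by have [[_ +] _] := FQ _ FD; apply => //; exact: D'D.
  - by move=> C [D FD DC]; have [_] := FQ _ FD; exact.
(* Maximality in the form used below: a set that compares correctly with every member of [E] already
   belongs to [E]. *)
have ins B : measurable B -> B `<=` A -> (P B = 0 -> B = set0)%E -> (P B = P A -> B = A) ->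
    (forall C, E C -> ((P C <= P B)%E -> C `<=` B) /\ ((P B <= P C)%E -> B `<=` C)) -> E B.
  move=> mB BA B0 BBA cB; apply: contrapT => nEB.
  apply: (maxE (E `|` [set B])).
    split; first by move=> C; left.
    by move=> /(_ B) /(_ (or_intror erefl)).
  split; first split.
  - by move=> C [/mE//|->].
  - move=> C C' [EC|->] [EC'|->] //; first exact: EE.
    + by case: (cB _ EC).
    + by case: (cB _ EC').
    + by move=> _.
  - by move=> C [/QE|->]; [exact|split].
have E0 : E set0.
  apply: ins => //; first by rewrite measure0 => PA; move: A0; rewrite -PA ltxx.
  move=> C EC; split; rewrite measure0 => C0; last exact: sub0set.
  have [_ CE _] := QE _ EC; rewrite CE//.
  by apply/eqP; rewrite -measure_le0.
have EA : E A.
  apply: ins => //; first by move=> PA; move: A0; rewrite PA ltxx.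
  move=> C EC; have [CA _ CAE] := QE _ EC; split => // AC.
  by rewrite CAE//; apply/eqP; rewrite eq_le AC andbT le_measure ?inE//; exact: mE.
have ins' B : measurable B -> B `<=` A ->
    (forall C, E C -> ((P C <= P B)%E -> C `<=` B) /\ ((P B <= P C)%E -> B `<=` C)) -> E B.
  move=> mB BA cB; apply: ins => // PB.
    by rewrite -subset0; apply: (cB _ E0).2; rewrite PB measure0.
  by apply/seteqP; split => //; apply: (cB _ EA).1; rewrite PB.
have EsubA C : E C -> C `<=` A by move=> /QE[].
exists E; split => // r r0; set t := r%:E => tA; apply: contrapT => not.
have {}not C : E C -> (P C < t)%E \/ (t < P C)%E.
  move=> EC; have [Ct|Ct|Ct] := ltgtP (P C) t; [by left|by right|].
  by exfalso; apply: not; exists C.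
pose Lo := \bigcup_(C in [set C | E C /\ (P C < t)%E]) C.
(* Complements in [A] of the larger sets form a chain as well, so the bound on unions applies to
   them and yields [t <= P M] for [M] the complement of [Hi]. *)
pose Hi := \bigcup_(C in [set A `\` C | C in [set C | E C /\ (t < P C)%E]]) C.
have [mLo Lot] : measurable Lo /\ (P Lo <= t)%E.
  have [|mL leL] := @measure_chain_bigcup [set C | E C /\ (P C < t)%E].
    by split => [C [/mE]|C C' [EC _] [EC' _]]//; exact: EE.
  by split => //; apply: leL => // C [_ /ltW].
pose p (C : set T) := fine (P C).
have pE C : measurable C -> P C = (p C)%:E.
  by move=> mC; rewrite /p fineK// fin_num_measure.
have pD C : measurable C -> C `<=` A -> P (A `\` C) = (p A - p C)%:E.
  move=> mC CA; transitivity (P A - P C)%E; last by rewrite !pE.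
  rewrite measureD//; last by rewrite ltey_eq fin_num_measure.
  by rewrite (setIidr CA).
have [mHi Hit] : measurable Hi /\ (P Hi <= P A - t)%E.
  have [|mH leH] := @measure_chain_bigcup [set A `\` C | C in [set C | E C /\ (t < P C)%E]].
    split => [_ [C [EC _] <-]|_ _ [C [EC _] <-] [C' [EC' _] <-]].
      by apply: measurableD => //; exact: mE.
    rewrite !pD; [|exact: mE|exact: EsubA|exact: mE|exact: EsubA].
    rewrite lee_fin => CC'; apply: setDS; apply: EE => //.
    by rewrite !pE ?lee_fin; [lra|exact: mE|exact: mE].
  split => //; apply: leH; first by move: tA; rewrite pE// -EFinB !lee_fin; lra.
  move=> _ [C [EC tC] <-]; rewrite pD; [|exact: mE|exact: EsubA].
  by move: tC; rewrite !pE//; [rewrite -EFinB lte_fin lee_fin; lra|exact: mE].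
have EE' C C' : E C -> E C' -> (P C < P C')%E -> C `<=` C' by move=> ? ? /ltW; exact: EE.
pose M := A `\` Hi.
have mM : measurable M by exact: measurableD.
have HiA : Hi `<=` A by move=> x [_ [C _ <-] []].
have tM : (t <= P M)%E.
  rewrite pD//; move: Hit; rewrite !pE//.
  by rewrite -EFinB !lee_fin; lra.
have LoC C : E C -> (P C < t)%E -> C `<=` Lo by move=> EC Ct x Cx; exists C.
have CLo C : E C -> (t < P C)%E -> Lo `<=` C.
  by move=> EC tC x [C' [EC' C't] C'x]; apply: (EE' C' C) => //; exact: lt_trans tC.
have CM C : E C -> (t < P C)%E -> M `<=` C.
  move=> EC tC x [Ax nHi]; apply: contrapT => nC; apply: nHi.
  by exists (A `\` C) => //; exists C.
have LoA : Lo `<=` A by move=> x [C [/EsubA CA _] /CA].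
have LoM : Lo `<=` M.
  move=> x Lox; split; first exact: LoA.
  by move=> [_ [C [EC tC] <-] [_]]; apply; exact: (CLo C).
(* Strict inequalities are required unless [B = Lo]: in a [measure_chain] a set with the measure of
   another member would have to equal it. *)
have between B : measurable B -> Lo `<=` B -> B `<=` M ->
    B = Lo \/ (P Lo < P B)%E /\ (P B < P M)%E -> E B.
  move=> mB LB BM PB; apply: ins' => //; first by move=> x /BM [].
  move=> C EC; case: (not C EC) => tC.
    split; first by move=> _; apply: subset_trans LB; exact: LoC.
    move=> BC; case: PB => [BLo|[LoB _]].
      move: BC; rewrite BLo => LoleC x [C' [EC' C't] C'x].
      apply: (EE _ _ EC' EC) C'x; apply: le_trans LoleC.
      by apply: le_measure; rewrite ?inE//; [exact: mE|exact: LoC].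
    suff : (P B < P B)%E by rewrite ltxx.
    apply: (le_lt_trans BC); apply: le_lt_trans LoB.
    by apply: le_measure; rewrite ?inE//; [exact: mE|exact: LoC].
  split; last by move=> _; apply: subset_trans BM _; exact: CM.
  suff BC : (P B < P C)%E by move=> /(lt_le_trans BC); rewrite ltxx.
  case: PB => [->|[_ BM']]; first exact: le_lt_trans tC.
  apply: (lt_le_trans BM').
  by apply: le_measure; rewrite ?inE//; [exact: mE|exact: CM].
have [PLo|PLo] := eqVneq (P Lo) t.
  have : E Lo by apply: between => //; left.
  by move=> /not; rewrite PLo ltxx => -[].
have {PLo}PLo : (P Lo < P M)%E by rewrite (lt_le_trans _ tM)// lt_neqAle PLo.
have PMLo : (P (M `\` Lo) = P M - P Lo)%E.
  by rewrite measureD//; [rewrite (setIidr LoM)|rewrite ltey_eq fin_num_measure].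
have [|B [mB BML B0 BM]] := naP (measurableD mM mLo).
- by rewrite PMLo !pE// -EFinB lte_fin subr_gt0 -lte_fin -!pE//.
have PLoB : (P (Lo `|` B) = P Lo + P B)%E.
  by rewrite measureU//; apply/seteqP; split => // x [Lox /BML[]].
have LoB : (P Lo < P (Lo `|` B))%E.
  by rewrite PLoB; move: B0; rewrite !pE// !lte_fin; lra.
have BMlt : (P (Lo `|` B) < P M)%E.
  rewrite PLoB; move: BM; rewrite PMLo !pE//.
  by rewrite -EFinB -EFinD !lte_fin; lra.
have BM' : Lo `|` B `<=` M by move=> x [/LoM//|/BML[]].
have EB : E (Lo `|` B).
  by apply: between => //; [exact: measurableU|right].
(* As a member of [E], the new set either has measure below [t] and lies inside [Lo], or has measure
   above [t] and contains [M]; its measure is strictly between those of [Lo] and [M], so both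
   fail. *)
case: (not _ EB) => tB.
  have : (P (Lo `|` B) <= P Lo)%E.
    by apply: le_measure; rewrite ?inE//; [exact: measurableU|exact: LoC].
  by rewrite leNgt LoB.
have : (P M <= P (Lo `|` B))%E.
  by apply: le_measure; rewrite ?inE//; [exact: measurableU|exact: CM].
by rewrite leNgt BMlt.
Qed.

End Nonatomic.

Section Uniform.
Context {d : measure_display} {T : measurableType d} {R : realType}.
Variable P : probability T R.

Lemma measurable_fun_lt_rays (f : T -> R) :
  (forall r, measurable [set x | f x < r]) -> measurable_fun setT f.
Proof.
move=> mf; apply: (measurability _ (RGenInftyO.measurableE R)) => //.
move=> _ [_ [r ->] <-]; rewrite setTI.
rewrite (_ : _ @^-1` _ = [set x | f x < r]); first exact: mf.
by apply/seteqP; split => x /=; rewrite in_itv/=.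
Qed.

(** Open left rays form a generating system stable under intersection, and the restrictions of [P]
    are finite. Two different sets [D] and [E] are allowed so that laws on different pieces can be
    compared. *)
Lemma eq_law_rays (f g : T -> R) D E : measurable D -> measurable E ->
  measurable_fun setT f -> measurable_fun setT g ->
  (forall r, P (D `&` [set x | f x < r]) = P (E `&` [set x | g x < r])) ->
  forall B, measurable B -> P (D `&` f @^-1` B) = P (E `&` g @^-1` B).
Proof.
move=> mD mE mf mg fg B mB.
pose f' : {mfun T >-> R} := HB.pack f (isMeasurableFun.Build _ _ _ _ _ mf).
pose g' : {mfun T >-> R} := HB.pack g (isMeasurableFun.Build _ _ _ _ _ mg).
have itvE (h : T -> R) r : h @^-1` `]-oo, r[ = [set x | h x < r].
  by apply/seteqP; split => x /=; rewrite in_itv/=.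
suff : pushforward (mrestr P mD) f' B = pushforward (mrestr P mE) g' B.
  by rewrite /pushforward /mrestr /= setIC => ->; rewrite setIC.
apply: (@measure_unique _ _ _ (@RGenInftyO.G R) (fun n => `]-oo, n%:R[%classic)
  (RGenInftyO.measurableE R)) => //.
- move=> _ _ [r ->] [s ->]; exists (Num.min r s).
  by apply/seteqP; split => x /=; rewrite !in_itv/= lt_min => /andP.
- by move=> n; exists n%:R.
- apply/seteqP; split => // x _; exists (Num.truncn x).+1 => //=.
  by rewrite in_itv/= truncnS_gt.
- move=> _ [r ->]; have := fg r; rewrite -!itvE => fgr.
  exact: (etrans (congr1 P (setIC _ _)) (etrans fgr (congr1 P (setIC _ _)))).
- move=> n; rewrite /pushforward /mrestr/= ltey_eq fin_num_measure//.
  by rewrite -[X in measurable X]setTI; exact: (mf measurableT).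
Qed.

Lemma le_measure_null (X Y N : set T) : measurable X -> measurable Y -> measurable N ->
  P N = 0%E -> X `<=` Y `|` N -> (P X <= P Y)%E.
Proof.
move=> mX mY mN N0 XYN; apply: (@le_trans _ _ (P (Y `|` N))).
  by apply: le_measure; rewrite ?inE//; exact: measurableU.
by rewrite measureU0.
Qed.

(** The values stay strictly inside the unit interval everywhere, even off [D]: quantile functions
    will be monotone only on the open interval. *)
Definition uniform_on (D : set T) (V : T -> R) : Prop :=
  [/\ measurable_fun setT V, forall x, 0 < V x < 1 &
    forall r, 0 <= r -> r <= 1 -> (P (D `&` [set x | V x < r]%R) = r%:E * P D)%E].

Lemma uniform_on_eq_law D E V W : measurable D -> measurable E -> P D = P E ->
  uniform_on D V -> uniform_on E W ->
  forall B, measurable B -> P (D `&` V @^-1` B) = P (E `&` W @^-1` B).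
Proof.
move=> mD mE DE [mV V01 VP] [mW W01 WP]; apply: eq_law_rays => // r.
have [r0|r0] := leP r 0.
  have empty (S : set T) (X : T -> R) : (forall x, 0 < X x < 1) ->
      S `&` [set x | X x < r] = set0.
    by move=> X01; apply/seteqP; split => // x [_ /=]; have := X01 x; lra.
  by rewrite !empty.
have [r1|r1] := leP r 1; first by rewrite VP ?WP// ?(ltW r0)//; congr (_ * _)%E; exact: DE.
have full (S : set T) (X : T -> R) : (forall x, 0 < X x < 1) ->
    S `&` [set x | X x < r] = S.
  by move=> X01; apply/seteqP; split => [x []//|x Sx]; split => //=; have := X01 x; lra.
by rewrite !full.
Qed.

Hypothesis naP : nonatomic P.

(** Let [G t] be the chain member of measure [t * P A]. The variable is the first level [t] at which
    [x] enters [G t]: its sublevel set at [r] contains each [G t] with [t < r] and lies in [G r], so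
    its measure is [r * P A]. *)
Lemma ex_uniform_on (A : set T) : measurable A -> (0 < P A)%E ->
  exists U, uniform_on A U.
Proof.
move=> mA A0; have [E [[mE EE] EA Et]] := nonatomic_chain naP mA A0.
have PAfin : P A \is a fin_num by exact: fin_num_measure.
set a := fine (P A); have aE : P A = a%:E by rewrite fineK.
have a0 : 0 < a by rewrite -lte_fin -aE.
have /choice[G GP] : forall t : R, exists C, 0 <= t <= 1 -> E C /\ P C = (t * a)%:E.
  move=> t; have [/andP[t0 t1]|t01] := boolP (0 <= t <= 1); last by exists set0.
  have [||C EC PC] := Et (t * a); first by rewrite mulr_ge0// ltW.
    by rewrite aE lee_fin ler_piMl// ltW.
  by exists C.
have GG s t : 0 <= s -> s <= t -> t <= 1 -> G s `<=` G t.
  move=> s0 st t1; have [|Es Ps] := GP s; first by apply/andP; split=> //; lra.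
  have [|Et' Pt] := GP t; first by apply/andP; split=> //; lra.
  by apply: EE => //; rewrite Ps Pt lee_fin ler_pM2r.
(* The level 1 is added so that the infimum is over a nonempty set also for points outside every
   [G t]. *)
pose S x := [set t | 0 <= t <= 1 /\ G t x] `|` [set 1].
have S0 x : S x !=set0 by exists 1; right.
have Slb x : has_lbound (S x) by exists 0 => t [[/andP[]]|->].
pose U x := inf (S x).
(* Rational levels suffice since [G] is monotone, which makes the union countable and [U]
   measurable. *)
have Ult r : r <= 1 -> [set x | U x < r] =
    \bigcup_(q : rat) (if 0 <= (ratr q : R) < r then G (ratr q) else set0).
  move=> r1; apply/seteqP; split => x /=.
    move=> /(inf_lt (S0 x)) [t St tr].
    case: St => [[/andP[t0 t1] Gt]|t1]; last by move: tr; rewrite t1 ltNge r1.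
    have [q] := rat_in_itvoo tr; rewrite in_itv/= => /andP[tq qr].
    exists q => //; rewrite qr (le_trans t0 (ltW tq))/=.
    by apply: GG Gt => //; [exact: ltW|rewrite (le_trans (ltW qr))].
  move=> [q _]; case: ifPn => // /andP[q0 qr] Gq; apply: le_lt_trans (qr).
  apply: ge_inf => //; left; split => //.
  by rewrite q0/= (le_trans (ltW qr)).
have mU : measurable_fun setT U.
  apply: measurable_fun_lt_rays => r; have [r1|r1] := leP r 1.
    rewrite Ult//; apply: bigcupT_measurable_rat => q; case: ifPn => // /andP[q0 qr].
    apply: mE; have [|//] := GP (ratr q).
    by rewrite q0 (le_trans (ltW qr)).
  rewrite (_ : [set x | _] = setT)//; apply/seteqP; split => // x _ /=.
  by apply: le_lt_trans r1; apply: ge_inf => //; right.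
have PU r : 0 <= r -> r <= 1 -> (P (A `&` [set x | U x < r]%R) = r%:E * P A)%E.
  move=> r0 r1.
  have mr s : measurable (A `&` [set x | U x < s]).
    apply: measurableI => //.
    rewrite (_ : [set x | _] = U @^-1` `]-oo, s[%classic); last first.
      by apply/seteqP; split => x /=; rewrite in_itv.
    by rewrite -[X in measurable X]setTI; apply: mU => //; exact: measurable_itv.
  have [|EGr PGr] := GP r; first by rewrite r0.
  set u := fine (P (A `&` [set x | U x < r])).
  have uE : P (A `&` [set x | U x < r]) = u%:E by rewrite fineK// fin_num_measure.
  have ule : u <= r * a.
    rewrite -lee_fin -uE -PGr; apply: le_measure; rewrite ?inE//; first exact: mE.
    rewrite Ult// => x [_ [q _]]; case: ifPn => // /andP[q0 qr].
    by apply: GG => //; exact: ltW.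
  have geu t : 0 <= t -> t < r -> t * a <= u.
    move=> t0 tr; have [|EGt PGt] := GP t; first by rewrite t0 (le_trans (ltW tr)).
    rewrite -lee_fin -uE -PGt; apply: le_measure; rewrite ?inE//; first exact: mE.
    move=> x Gx; split; first exact: EA Gx.
    apply: le_lt_trans (tr); apply: ge_inf => //; left; split => //.
    by rewrite t0 (le_trans (ltW tr)).
  rewrite uE aE -EFinM; congr EFin; apply/eqP; rewrite eq_le ule/= leNgt.
  apply/negP => ur.
  have u0 : 0 <= u by rewrite -lee_fin -uE.
  have h := geu ((u / a + r) / 2).
  have hE : (u / a + r) / 2 * a = (u + r * a) / 2 by field; rewrite gt_eqF.
  have uar : u / a < r by rewrite ltr_pdivrMr.
  have ua0 : 0 <= u / a by rewrite divr_ge0// ltW.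
  have : u < (u + r * a) / 2 by lra.
  by rewrite -hE ltNge h//; lra.
have mlt s : measurable [set x | U x < s].
  rewrite (_ : [set x | _] = U @^-1` `]-oo, s[%classic); last first.
    by apply/seteqP; split => x /=; rewrite in_itv.
  by rewrite -[X in measurable X]setTI; apply: mU => //; exact: measurable_itv.
have mle s : measurable [set x | U x <= s].
  rewrite (_ : [set x | _] = U @^-1` `]-oo, s]%classic); last first.
    by apply/seteqP; split => x /=; rewrite in_itv.
  by rewrite -[X in measurable X]setTI; apply: mU => //; exact: measurable_itv.
(* On [A], the variable leaves the open unit interval only on this null set; it is reset there to
   1/2. *)
pose N := (A `&` [set x | U x <= 0]) `|` (A `\` [set x | U x < 1]).
have mN : measurable N.
  by apply: measurableU; [exact: measurableI|exact: measurableD].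
have N0 : P N = 0%E.
  apply: null_set_setU => //; [exact: measurableI|exact: measurableD| |]; last first.
    rewrite measureD//; last by rewrite ltey_eq fin_num_measure.
    have := PU 1 ler01 (lexx 1); rewrite mul1e => PU1.
    transitivity (P A - P A)%E; last by rewrite subee.
    by congr (_ - _)%E; exact: PU1.
  set u := fine (P (A `&` [set x | U x <= 0])).
  have uE : P (A `&` [set x | U x <= 0]) = u%:E.
    by rewrite fineK// fin_num_measure//; exact: measurableI.
  have u0 : 0 <= u by rewrite -lee_fin -uE.
  have ule r : 0 < r -> r <= 1 -> u <= r * a.
    move=> r0 r1; rewrite -lee_fin -uE EFinM -aE -PU ?(ltW r0)//.
    apply: le_measure; rewrite ?inE; [exact: measurableI|exact: measurableI|].
    by move=> x [Ax] /= /le_lt_trans /(_ r0).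
  rewrite [LHS]uE; congr EFin; apply/eqP; rewrite eq_le u0 andbT leNgt; apply/negP => up.
  have ua : u <= a by have := ule 1 ltr01 (lexx 1); rewrite mul1r.
  have ua0 : 0 < u / a / 2 by rewrite !divr_gt0.
  have := ule (u / a / 2) ua0.
  have -> : u / a / 2 * a = u / 2 by field; rewrite gt_eqF.
  have ua1 : u / a <= 1 by rewrite ler_pdivrMr// mul1r.
  by move=> h; have : u <= u / 2 by [apply: h; lra]; lra.
pose U' x := if 0 < U x < 1 then U x else 2^-1.
have mU' : measurable_fun setT U'.
  apply: measurable_fun_ifT => //.
  by apply: measurable_and; exact: measurable_fun_ltr.
exists U'; split => //.
  by move=> x; rewrite /U'; case: ifPn => // _; rewrite invr_gt0 invf_lt1//; lra.
move=> r r0 r1; rewrite -PU//; apply/eqP; rewrite eq_le.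
have mlt' : measurable (A `&` [set x | U' x < r]).
  apply: measurableI => //.
  rewrite (_ : [set x | _] = U' @^-1` `]-oo, r[%classic); last first.
    by apply/seteqP; split => x /=; rewrite in_itv.
  by rewrite -[X in measurable X]setTI; apply: mU' => //; exact: measurable_itv.
have NE x : A x -> ~ N x -> U' x = U x.
  move=> Ax nN; rewrite /U' ifT//; apply/andP; split; rewrite ltNge; apply/negP => h; apply: nN.
    by left.
  by right; split => //=; apply/negP; rewrite -leNgt.
apply/andP; split; apply: (@le_measure_null _ _ N) => //; try exact: measurableI.
  move=> x [Ax Ux]; have [Nx|nN] := pselect (N x); [by right|left]; split => //=.
  by rewrite -NE.
move=> x [Ax Ux]; have [Nx|nN] := pselect (N x); [by right|left]; split => //=.
by rewrite NE.
Qed.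

End Uniform.

(** * Quantile functions: monotone rearrangement on a set *)

Section Quantile.
Context {d : measure_display} {T : measurableType d} {R : realType}.
Variable P : probability T R.

Lemma measurable_lt_rays (f : T -> R) r : measurable_fun setT f -> measurable [set x | f x < r].
Proof.
move=> mf; rewrite (_ : [set x | _] = f @^-1` `]-oo, r[%classic); last first.
  by apply/seteqP; split => x /=; rewrite in_itv.
by rewrite -[X in measurable X]setTI; exact: mf.
Qed.

Lemma lt_measure_bigcup (F : nat -> set T) (u : \bar R) : (forall n, measurable (F n)) ->
  (forall m n, (m <= n)%N -> F m `<=` F n) -> (u < P (\bigcup_n F n))%E ->
  exists n, (u < P (F n))%E.
Proof.
move=> mF ndF uF; apply: contrapT => nu.
have cv : P (F n) @[n --> \oo] --> P (\bigcup_n F n).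
  apply: nondecreasing_cvg_mu => //; first exact: bigcupT_measurable.
  by move=> m n mn; apply/subsetPset; exact: ndF.
move: uF; apply/negP; rewrite -leNgt -(cvg_lim _ cv)//; apply: lime_le.
  by apply/cvg_ex; exists (P (\bigcup_n F n)).
by apply: nearW => n; rewrite leNgt; apply/negP => h; apply: nu; exists n.
Qed.

(** [q] is the generalized inverse of the distribution function [G] of [Z] conditioned on [A]. The
    equivalence of [q u < r] with [u < G r] reduces the law of [q \o U] to that of [U]. *)
Lemma ex_quantile (A : set T) (U Z : T -> R) : measurable A -> (0 < P A)%E ->
  measurable_fun setT Z -> uniform_on P A U ->
  exists q : R -> R, [/\ measurable_fun setT q,
    (forall s t, 0 < s -> s <= t -> t < 1 -> q s <= q t) &
    forall B, measurable B -> P (A `&` (q \o U) @^-1` B) = P (A `&` Z @^-1` B)].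
Proof.
move=> mA A0 mZ [mU U01 PU].
have PAfin : P A \is a fin_num by exact: fin_num_measure.
set a := fine (P A); have aE : P A = a%:E by rewrite fineK.
have a0 : 0 < a by rewrite -lte_fin -aE.
have mAZ r : measurable (A `&` [set x | Z x < r]).
  by apply: measurableI => //; exact: measurable_lt_rays.
pose G r := fine (P (A `&` [set x | Z x < r])) / a.
have GE r : P (A `&` [set x | Z x < r]) = (G r * a)%:E.
  by rewrite divfK ?gt_eqF// fineK// fin_num_measure.
have G_homo r s : r <= s -> G r <= G s.
  move=> rs; rewrite -(ler_pM2r a0) -lee_fin -!GE; apply: le_measure; rewrite ?inE//.
  by move=> x [Ax /= Zr]; split => //=; exact: lt_le_trans rs.
have G0 r : 0 <= G r by rewrite divr_ge0// ?fine_ge0// ltW.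
have G1 r : G r <= 1.
  by rewrite -(ler_pM2r a0) -lee_fin -!GE mul1r -aE; apply: le_measure; rewrite ?inE.
(* [G r] counts the strict inequality [Z < r], so [G] is left continuous; this gives the strict
   equivalence [qlt]. *)
have Gleft r u : u < G r -> exists2 s, s < r & u < G s.
  move=> uG; pose F n := A `&` [set x | Z x < r - n.+1%:R^-1].
  have [|m n mn|//|n] := @lt_measure_bigcup F (u * a)%:E; first by move=> n; exact: mAZ.
    move=> x [Ax /= Zx]; split => //=; apply: (lt_le_trans Zx).
    by rewrite lerD2l lerN2 lef_pV2 ?posrE// ler_nat.
    rewrite (_ : \bigcup_n F n = A `&` [set x | Z x < r]); first by rewrite GE lte_fin ltr_pM2r.
    apply/seteqP; split => [x [n _ [Ax /= Zx]]|x [Ax /= Zx]].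
      by split => //=; apply: (lt_le_trans Zx); rewrite gerBl.
    have rZ : 0 < r - Z x by rewrite subr_gt0.
    have [N _ /(_ N (leqnn N))] := near_infty_natSinv_lt (PosNum rZ).
    move=> /= h; exists N => //; split => //=.
    by rewrite ltrBrDr -ltrBrDl.
  by rewrite GE lte_fin ltr_pM2r// => h; exists (r - n.+1%:R^-1) => //; rewrite gtrBl.
have Gtop u : u < 1 -> exists s, u < G s.
  move=> u1; pose F n := A `&` [set x | Z x < n%:R].
  have [|m n mn|//|n] := @lt_measure_bigcup F (u * a)%:E; first by move=> n; exact: mAZ.
    move=> x [Ax /= Zx]; split => //=; apply: (lt_le_trans Zx).
    by rewrite ler_nat.
    rewrite (_ : \bigcup_n F n = A); first by rewrite aE lte_fin gtr_pMl.
    apply/seteqP; split => [x [n _ []]//|x Ax].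
    by exists (Num.truncn (Z x)).+1 => //; split => //=; rewrite truncnS_gt.
  by rewrite GE lte_fin ltr_pM2r// => h; exists n%:R.
have Gbot u : 0 < u -> exists s, G s <= u.
  move=> u0; pose F n := A `\` (A `&` [set x | Z x < - n%:R]).
  have PF n : P (F n) = ((1 - G (- n%:R)) * a)%:E.
    transitivity (P A - P (A `&` [set x | (Z x < - n%:R)%R]))%E.
      rewrite measureD//; last by rewrite ltey_eq fin_num_measure.
      by rewrite setIA setIid.
    by rewrite aE GE -EFinB mulrBl mul1r.
  have [|m n mn|//|n] := @lt_measure_bigcup F ((1 - u) * a)%:E.
    by move=> n; apply: measurableD.
    move=> x [Ax /= nZx]; split => //= -[_ Zx]; apply: nZx; split => //; apply: (lt_le_trans Zx).
    by rewrite lerN2 ler_nat.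
    rewrite (_ : \bigcup_n F n = A); first by rewrite aE lte_fin gtr_pMl// gtrBl.
    apply/seteqP; split => [x [n _ []]//|x Ax].
    exists (Num.truncn (- Z x)).+1 => //; split => //= -[_].
    by rewrite ltrNr => /lt_trans /(_ (truncnS_gt _)); rewrite ltxx.
  by rewrite PF lte_fin ltr_pM2r// => h; exists (- n%:R); lra.
(* Inside the open interval, [Gbot] makes the set nonempty and [Gtop] bounds it. The default [0]
   outside is never met, since [U] avoids those values. *)
pose q u := if 0 < u < 1 then sup [set r | G r <= u] else 0.
have supG u : 0 < u < 1 -> has_sup [set r | G r <= u].
  move=> /andP[u0 u1]; split; first by have [s Gs] := Gbot u u0; exists s.
  have [s Gs] := Gtop u u1; exists s => r /= Gr; rewrite leNgt; apply/negP => /ltW /G_homo; lra.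
have qlt u r : 0 < u < 1 -> (q u < r) = (u < G r).
  move=> u01; rewrite /q u01; apply/idP/idP.
    apply: contraTT; rewrite -!leNgt => Gru; apply: ub_le_sup => //.
    by case: (supG _ u01).
  move=> /Gleft[s sr us]; apply: (le_lt_trans _ sr); apply: ge_sup.
    by case: (supG _ u01).
  by move=> t /= Gt; rewrite leNgt; apply/negP => /ltW /G_homo; lra.
have mq : measurable_fun setT q.
  have -> : q = q \_ `]0, 1[%classic.
    apply/funext => u; rewrite /patch; case: ifPn => // /negP u01.
    by rewrite /q ifF//; apply/negP => h; apply: u01; rewrite inE/= in_itv.
  apply/(measurable_restrictT _ _).1 => //.
  apply: (measurability _ (RGenInftyO.measurableE R)) => //.
  move=> _ [_ [r ->] <-].
  rewrite (_ : _ `&` _ = `]0, 1[%classic `&` `]-oo, G r[%classic).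
    by apply: measurableI; exact: measurable_itv.
  by apply/seteqP; split => u [] /=; rewrite !in_itv/= => u01; rewrite qlt.
exists q; split => //.
  move=> s t s0 st t1; rewrite leNgt qlt ?(lt_le_trans s0)//; apply/negP => tG.
  have : q s < q s by rewrite qlt; [exact: le_lt_trans tG|rewrite s0 (le_lt_trans st)].
  by rewrite ltxx.
apply: eq_law_rays => //; first exact: measurableT_comp.
move=> r; rewrite GE (_ : [set x | _] = [set x | U x < G r]).
  by rewrite PU// EFinM aE.
by apply/seteqP; split => x /=; rewrite qlt.
Qed.

End Quantile.

(** * Cyclic rearrangements *)

Section CyclicCopies.
Context {d : measure_display} {T : measurableType d} {R : realType}.
Variable P : probability T R.
Hypothesis naP : nonatomic P.

(* The pieces [I x = i] have equal measure, and [V] has the same law on each of them: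
   permuting the indices [i] therefore preserves the law of any function of [(I, V)]. *)
Lemma ex_uniform_pieces (A : set T) n : measurable A -> (0 < P A)%E ->
  exists (I : T -> 'I_n.+1) (V : T -> R),
  [/\ (forall i, measurable [set x | I x = i]),
      measurable_fun setT V,
      (forall x, 0 < V x < 1),
      (forall i j B, measurable B ->
        P (A `&` [set x | I x = i] `&` V @^-1` B) = P (A `&` [set x | I x = j] `&` V @^-1` B)) &
      uniform_on P A (fun x => ((I x)%:R + V x) / n.+1%:R)].
Proof.
move=> mA A0; have [U [mU U01 PU]] := ex_uniform_on naP mA A0.
set m := n.+1%:R : R; have m0 : 0 < m by rewrite ltr0n.
have PAfin : P A \is a fin_num by exact: fin_num_measure.
set a := fine (P A); have aE : P A = a%:E by rewrite fineK.
have a0 : 0 < a by rewrite -lte_fin -aE.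
have mlt f r : measurable_fun setT f -> measurable [set x : T | (f x : R) < r].
  by move=> mf; exact: measurable_lt_rays.
pose I x : 'I_n.+1 := inord (Num.truncn (m * U x)).
have mU0 x : 0 <= m * U x by rewrite mulr_ge0// ltW//; case/andP: (U01 x).
have Itrunc x : (I x : nat) = Num.truncn (m * U x).
  rewrite inordK// ltnS leqNgt; apply/negP; rewrite truncn_gt_nat.
  by rewrite -/m -[leLHS]mulr1 ler_pM2l// leNgt; case/andP: (U01 x) => _ ->.
have IP x : (I x)%:R <= m * U x < (I x).+1%:R by rewrite Itrunc truncn_itv.
have IE i x : (I x = i) <-> (i%:R / m <= U x /\ U x < i.+1%:R / m).
  have -> : (i%:R / m <= U x /\ U x < i.+1%:R / m) <-> (i%:R <= m * U x < i.+1%:R).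
    by rewrite ler_pdivrMr// ltr_pdivlMr// mulrC; split => /andP.
  split=> [<-//|]; rewrite -truncn_eq// => /eqP h.
  by apply/val_inj; rewrite /= -h -Itrunc.
have PU2 s t : 0 <= s -> s <= t -> t <= 1 ->
    P (A `&` [set x | s <= U x /\ U x < t]) = ((t - s) * a)%:E.
  move=> s0 st t1; rewrite (_ : A `&` _ = (A `&` [set x | U x < t]) `\` (A `&` [set x | U x < s])); last first.
    apply/seteqP; split => x /=.
      by move=> [Ax [sU Ut]]; do !split => // -[_]; rewrite ltNge sU.
    move=> [[Ax Ut] nUs]; do !split => //; rewrite leNgt; apply/negP => h; exact: nUs.
  transitivity (P (A `&` [set x | U x < t]%R) - P (A `&` [set x | U x < s]%R))%E.
    rewrite measureD//; [|exact/measurableI/mlt|exact/measurableI/mlt|].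
      congr (_ - P _)%E; rewrite setIACA setIid; congr (_ `&` _).
      by apply/seteqP; split => [x []//|x /= Us]; split => //=; exact: lt_le_trans st.
    by rewrite ltey_eq fin_num_measure//; exact/measurableI/mlt.
  by rewrite !PU ?(le_trans s0)// ?(le_trans st)// aE -!EFinM -EFinB mulrBl.
have mI i : measurable [set x | I x = i].
  rewrite (_ : [set x | _] = [set x | U x < i.+1%:R / m] `\` [set x | U x < i%:R / m]).
    by apply: measurableD; exact: mlt.
  apply/seteqP; split => x /=.
    by move=> /IE[sU Ut]; split => //; apply/negP; rewrite -leNgt.
  by move=> [Ut /negP]; rewrite -leNgt => h; apply/IE.
have im i : (i < n.+1)%N -> i.+1%:R / m <= 1.
  by move=> ?; rewrite ler_pdivrMr// mul1r ler_nat.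
have PI i : P (A `&` [set x | I x = i]) = (a / m)%:E.
  rewrite (_ : [set x | _] = [set x | i%:R / m <= U x /\ U x < i.+1%:R / m]).
    rewrite PU2 ?divr_ge0 ?im//; last by rewrite ler_pM2r ?invr_gt0// ler_nat.
    by congr EFin; rewrite -mulrBl -natrB// subSnn; field; rewrite gt_eqF.
  by apply/seteqP; split => x /IE.
have /choice[W WP] : forall i, exists W, uniform_on P (A `&` [set x | I x = i]) W.
  by move=> i; apply: ex_uniform_on => //; [exact: measurableI|rewrite PI lte_fin divr_gt0].
have mW i : measurable_fun setT (W i) by case: (WP i).
have W01 i x : 0 < W i x < 1 by case: (WP i).
(* A separate uniform variable is taken on each piece. The pieces have equal measure, so the law of
   [V] on a piece does not depend on the piece. *)
pose V x := W (I x) x.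
have mV : measurable_fun setT V.
  apply: measurable_fun_lt_rays => r.
  rewrite (_ : [set x | _] = \bigcup_(i in [set: 'I_n.+1]) ([set x | I x = i] `&` [set x | W i x < r])).
    by apply: fin_bigcup_measurable => // i _; apply: measurableI => //; exact: mlt.
  by apply/seteqP; split => [x /= Vr|x [i _ [/= <-]]//]; exists (I x).
have V01 x : 0 < V x < 1 by exact: W01.
have VW i (S : set R) : A `&` [set x | I x = i] `&` V @^-1` S = A `&` [set x | I x = i] `&` W i @^-1` S.
  by apply/seteqP; split => x [[Ax Ix] Sx]; do !split => //; move: Sx; rewrite /= /V Ix.
exists I, V; split => //.
  move=> i j B mB; rewrite !VW; apply: uniform_on_eq_law => //; [exact: measurableI|exact: measurableI|].
  by rewrite [LHS]PI; exact/esym/PI.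
split.
- apply: measurable_funM => //; apply: measurable_funD => //.
  apply: measurable_fun_lt_rays => r.
  rewrite (_ : [set x | _] = \bigcup_(i in [set i : 'I_n.+1 | i%:R < r]) [set x | I x = i]).
    by apply: fin_bigcup_measurable.
  by apply/seteqP; split => [x /= h|x [i /= ir ->]//]; exists (I x).
- move=> x; have /andP[V0 V1] := V01 x; apply/andP; split.
    by rewrite divr_gt0// ltr_wpDl.
  rewrite ltr_pdivrMr// mul1r /m -natr1 ler_ltD// ler_nat.
  by rewrite -ltnS.
(* The case [r = 1] is set apart because the truncation of [m * r] would then be [n.+1], which is
   not an index. *)
move=> r r0; rewrite le_eqVlt => /predU1P[->|r1].
  rewrite mul1e; congr (P _); apply/seteqP; split => [x []//|x Ax]; split => //=.
  have /andP[V0 V1] := V01 x.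
  rewrite ltr_pdivrMr// mul1r /m -natr1 ler_ltD// ler_nat.
  by rewrite -ltnS.
have mr0 : 0 <= m * r by rewrite mulr_ge0// ltW.
have jm : (Num.truncn (m * r) < n.+1)%N.
  rewrite ltnNge; apply/negP => /=; rewrite truncn_ge_nat//.
  by rewrite -/m -[leLHS]mulr1 ler_pM2l// leNgt r1.
pose j := Ordinal jm.
have /andP[jr rj] : j%:R <= m * r < j.+1%:R by exact: truncn_itv.
(* With [j] the integer part of [m * r], the pieces before [j] lie wholly in the event and together
   form [U < j / m]; piece [j] contributes through [V], and later pieces not at all. *)
have -> : A `&` [set x | ((I x)%:R + V x) / m < r] =
    (A `&` [set x | U x < j%:R / m]) `|` (A `&` [set x | I x = j] `&` [set x | W j x < m * r - j%:R]).
  apply/seteqP; split => x /=.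
    rewrite ltr_pdivrMr// [r * m]mulrC => -[Ax Vr].
    have /andP[V0 V1] := V01 x; have /andP[IU UI] := IP x.
    have [Ij|Ij|Ij] := ltngtP (I x) j.
    - left; split => //; rewrite ltr_pdivlMr// mulrC (lt_le_trans UI)//.
      by rewrite ler_nat.
    - have jI : j.+1%:R <= (I x)%:R :> R by rewrite ler_nat.
      have : m * r < m * r.
        apply: (lt_le_trans rj); apply: (le_trans jI); apply: (le_trans _ (ltW Vr)).
        by rewrite lerDl ltW.
      by rewrite ltxx.
    - have {}Ij : I x = j by exact/val_inj.
      right; do !split => //; have -> : W j x = V x by rewrite /V Ij.
      by rewrite ltrBrDl; move: Vr; rewrite Ij.
  have /andP[V0 V1] := V01 x; have /andP[IU UI] := IP x.
  move=> [[Ax Uj]|[[Ax Ij] Vj]]; split => //; rewrite ltr_pdivrMr// [r * m]mulrC.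
    move: Uj; rewrite ltr_pdivlMr// [U x * m]mulrC => Uj.
    have := le_lt_trans IU Uj; rewrite ltr_nat => Ij.
    apply: (lt_le_trans _ jr); apply: (@lt_le_trans _ _ (I x).+1%:R); last by rewrite ler_nat.
    by rewrite -natr1 ltrD2l.
  by rewrite /V Ij -ltrBrDl.
have jrm : j%:R / m <= 1 by rewrite ler_pdivrMr// mul1r ler_nat ltnW.
rewrite measureU; first last.
- apply/seteqP; split => // x [[Ax Uj] [[_ /IE [jU _]] _]].
  by move: Uj => /=; rewrite ltNge jU.
- by apply: measurableI; [exact: measurableI|exact: mlt].
- by apply: measurableI => //; exact: mlt.
have [_ _ PW] := WP j.
have rj1 : m * r - j%:R <= 1 by move: rj; rewrite -natr1; lra.
transitivity ((j%:R / m)%:E * P A + (m * r - j%:R)%:E * (a / m)%:E)%E.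
  congr (_ + _)%E; first by apply: PU => //; exact: divr_ge0.
  by rewrite -(PI j) -PW// ?subr_ge0.
by rewrite aE -!EFinM -EFinD; congr EFin; field; rewrite gt_eqF.
Qed.

End CyclicCopies.

Section CyclicCopiesLaw.
Context {d : measure_display} {T : measurableType d} {R : realType}.
Variable P : probability T R.
Hypothesis naP : nonatomic P.

(** [I x + k] is addition modulo [n.+1]: it permutes pieces that carry the same law of [V], so each
    copy keeps the law of [q] applied to a uniform variable, which is that of [Z] on [A]. Even for
    [k = 0] the copy agrees with [Z] on [A] only in law. *)
Lemma ex_cyclic_copies (A : set T) (Z : T -> R) n : measurable A -> (0 < P A)%E ->
  measurable_fun setT Z ->
  exists (I : T -> 'I_n.+1) (V : T -> R) (q : R -> R),
  [/\ (forall x, 0 < V x < 1),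
      (forall s t, 0 < s -> s <= t -> t < 1 -> q s <= q t) &
      forall k : 'I_n.+1,
        let f x := if x \in A then q (((I x + k)%R%:R + V x) / n.+1%:R) else Z x in
        measurable_fun setT f /\ same_law P f Z].
Proof.
move=> mA A0 mZ.
have [I [V [mI mV V01 nu UW]]] := ex_uniform_pieces naP n mA A0.
have [q [mq q_homo qZ]] := ex_quantile mA A0 mZ UW.
exists I, V, q; split => // k f.
have mpre (g : T -> R) B : measurable_fun setT g -> measurable B -> measurable (g @^-1` B).
  by move=> mg mB; rewrite -[X in measurable X]setTI; exact: mg.
pose piece i (S : set R) := A `&` [set x | I x = i] `&` V @^-1` S.
have mpiece i S : measurable S -> measurable (piece i S).
  by move=> mS; apply: measurableI; [exact: measurableI|exact: mpre].
(* Every piece is measured on piece [ord0]; the measure of the union becomes a sum in which the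
   shift by [k] is a mere reindexing. *)
have PU (S : 'I_n.+1 -> set R) : (forall i, measurable (S i)) ->
    P (\bigcup_i piece i (S i)) = (\sum_(i < n.+1) P (piece ord0 (S i)))%E.
  move=> mS; rewrite measure_fin_bigcup//=.
  - rewrite (_ : [set: 'I_n.+1] = [set` index_enum 'I_n.+1]); last first.
      by apply/seteqP; split => // i _ /=; rewrite mem_index_enum.
    rewrite -fsbig_seq ?index_enum_uniq//; apply: eq_bigr => i _; exact: nu.
  - by move=> i j _ _ [x [[[_ /= <-] _] [[_ /= <-] _]]].
  - by move=> i _; exact: mpiece.
pose S (B : set R) (j : 'I_n.+1) := [set v | B (q ((j%:R + v) / n.+1%:R))].
have mS B j : measurable B -> measurable (S B j).
  move=> mB; pose h v := q ((j%:R + v) / n.+1%:R).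
  have mh : measurable_fun setT h.
    by apply: measurableT_comp => //; apply: measurable_funM => //; exact: measurable_funD.
  by rewrite -[X in measurable X]setTI; exact: (mh measurableT B mB).
have fE B : f @^-1` B = (Z @^-1` B `\` A) `|` \bigcup_i piece i (S B (i + k)%R).
  apply/seteqP; split => x /=; rewrite /f.
    case: ifPn => [/set_mem Ax Bx|/negP nA Bx]; last by left; split => // /mem_set.
    by right; exists (I x).
  move=> [[Bx nA]|[i _ [[Ax /= Ii] Bx]]]; first by rewrite memNset.
  by rewrite mem_set// Ii.
have mf : measurable_fun setT f.
  move=> _ B mB; rewrite setTI fE; apply: measurableU.
    by apply: measurableD => //; exact: mpre.
  by apply: fin_bigcup_measurable => // i _; apply: mpiece; exact: mS.
split => // B mB.
have ZE : Z @^-1` B = (Z @^-1` B `\` A) `|` (A `&` Z @^-1` B) by rewrite setIC setUC setUIDK.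
have disj (X Y : set T) : Y `<=` A -> (X `\` A) `&` Y = set0.
  by move=> YA; apply/seteqP; split => // x [[_ nA] /YA].
have mBA : measurable (Z @^-1` B `\` A) by apply: measurableD => //; exact: mpre.
have mU (G : 'I_n.+1 -> set R) : (forall i, measurable (G i)) -> measurable (\bigcup_i piece i (G i)).
  by move=> mG; apply: fin_bigcup_measurable => // i _; exact: mpiece.
have UA (G : 'I_n.+1 -> set R) : \bigcup_i piece i (G i) `<=` A by move=> x [i _ [[]]].
rewrite fE [in RHS]ZE measureU//; [|by apply: mU => i; exact: mS|exact/disj/UA].
rewrite [RHS]measureU//; [|by apply: measurableI => //; exact: mpre|by apply: disj; exact: subIsetl].
congr (_ + _)%E.
transitivity (P (\bigcup_i piece i (S B i))).
  rewrite [LHS]PU; last by move=> i; exact: mS.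
  rewrite PU; last by move=> i; exact: mS.
  by rewrite [RHS](reindex_inj (addIr k)).
apply: etrans (qZ _ mB); congr (P _); apply/seteqP; split => x.
  by move=> [i _ [[Ax /= Ii] Bx]]; split => //=; rewrite Ii.
by move=> [Ax Bx]; exists (I x).
Qed.

End CyclicCopiesLaw.

(** * Cell means and Jensen's inequality *)

Section Averages.
Context {d : measure_display} {T : measurableType d} {R : realType}.
Variable P : probability T R.

Definition convex_funs (S : set (T -> R)) : Prop :=
  forall X Y (t : R), S X -> S Y -> 0 <= t -> t <= 1 -> S (fun x => t * X x + (1 - t) * Y x).

Lemma convex_funs_average (S : set (T -> R)) n (f : 'I_n.+1 -> T -> R) : convex_funs S ->
  (forall k, S (f k)) -> S (fun x => (\sum_k f k x) / n.+1%:R).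
Proof.
move=> cS; elim: n f => [|n IH] f Sf.
  by rewrite (_ : (fun x => _) = f ord0)//; apply/funext => x; rewrite big_ord1 divr1.
pose t : R := n.+1%:R / n.+2%:R.
have n0 k : k.+1%:R != 0 :> R by rewrite pnatr_eq0.
rewrite (_ : (fun x => _) = (fun x =>
    t * ((\sum_(k < n.+1) f (widen_ord (leqnSn _) k) x) / n.+1%:R) + (1 - t) * f ord_max x)).
  apply: cS => //; first exact: IH.
  - by rewrite divr_ge0.
  - by rewrite ler_pdivrMr ?ltr0n// mul1r ler_nat.
apply/funext => x; rewrite big_ord_recr/=.
have -> : 1 - t = n.+2%:R^-1.
  rewrite /t -[X in X - _](@mulfV _ n.+2%:R)//.
  by rewrite -mulrBl -natrB// subSnn mul1r.
by rewrite mulrDl [f _ x / _]mulrC; congr (_ + _); rewrite /t mulrCA mulrAC divff// mul1r mulrC.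
Qed.

(** On a null cell the value is [0], the inverse of [0] being [0]. *)
Definition cell_mean (A : set T) (X : T -> R) : R :=
  (\int[P]_(x in A) X x) / fine (P A).

Lemma cell_meanB (A : set T) (X Y : T -> R) : measurable A ->
  P.-integrable A (EFin \o X) -> P.-integrable A (EFin \o Y) ->
  cell_mean A (X \- Y) = cell_mean A X - cell_mean A Y.
Proof. by move=> mA iX iY; rewrite /cell_mean RintegralB// mulrBl. Qed.

Lemma fine_prob_gt0 (A : set T) : measurable A -> (0 < P A)%E -> 0 < fine (P A).
Proof. by move=> mA A0; rewrite fine_gt0// A0/= ltey_eq fin_num_measure. Qed.

Lemma cell_mean_osc (A : set T) (X : T -> R) (e : R) : measurable A -> (0 < P A)%E ->
  P.-integrable A (EFin \o X) -> (forall x y, A x -> A y -> `|X x - X y| <= e) ->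
  forall x, A x -> `|X x - cell_mean A X| <= e.
Proof.
move=> mA A0 iX Xe x Ax; have a0 := fine_prob_gt0 mA A0.
have icst c : P.-integrable A (EFin \o cst c) by exact: finite_measure_integrable_cst.
have Xlb : cell_mean A X <= X x + e.
  rewrite /cell_mean ler_pdivrMr// -Rintegral_cst//; apply: le_Rintegral; [by []|exact: iX|exact: icst|move=> y Ay].
  by have := Xe y x Ay Ax; rewrite ler_norml => /andP[_]; rewrite lerBlDl.
have Xub : X x - e <= cell_mean A X.
  rewrite /cell_mean ler_pdivlMr// -Rintegral_cst//; apply: le_Rintegral; [by []|exact: icst|exact: iX|move=> y Ay].
  by have := Xe y x Ay Ax; rewrite ler_norml => /andP[+ _]; lra.
by rewrite ler_norml; apply/andP; split; lra.
Qed.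

Lemma same_law_ge0_integral (X Y : T -> R) (h : R -> \bar R) : measurable_fun setT X ->
  measurable_fun setT Y -> same_law P X Y -> measurable_fun setT h -> (forall r, 0 <= h r)%E ->
  (\int[P]_x h (X x) = \int[P]_x h (Y x))%E.
Proof.
move=> mX mY XY mh h0.
have := @ge0_integral_pushforward _ _ _ _ _ _ mX P setT h measurableT mh (fun r _ => h0 r).
have := @ge0_integral_pushforward _ _ _ _ _ _ mY P setT h measurableT mh (fun r _ => h0 r).
rewrite !preimage_setT /= => <- <-.
by apply: eq_measure_integral => B mB _; exact: XY.
Qed.

Lemma same_law_Rintegral (X Y : T -> R) : measurable_fun setT X -> measurable_fun setT Y ->
  same_law P X Y -> \int[P]_x X x = \int[P]_x Y x.
Proof.
move=> mX mY XY; rewrite /Rintegral integralE [in RHS]integralE; congr (fine (_ - _)%E).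
  under [LHS]eq_integral do rewrite funeposE.
  under [RHS]eq_integral do rewrite funeposE.
  apply: (@same_law_ge0_integral X Y (fun r => maxe r%:E 0)) => //.
    by apply: measurable_maxe => //; exact: measurable_EFin.
  by move=> r; rewrite le_max lexx orbT.
under [LHS]eq_integral do rewrite funenegE.
under [RHS]eq_integral do rewrite funenegE.
apply: (@same_law_ge0_integral X Y (fun r => maxe (- r%:E) 0)%E) => //.
  by apply: measurable_maxe => //; apply: measurableT_comp => //; exact: measurable_EFin.
by move=> r; rewrite le_max lexx orbT.
Qed.

End Averages.

(** * Supporting lines, Jensen's inequality and tails for the modular *)

Section ModularEstimates.
Context {d : measure_display} {T : measurableType d} {R : realType}.
Variables (P : probability T R) (Phi : R -> R).
Hypothesis orlPhi : orlicz_function Phi.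

(** The slope is the supremum of the slopes of the chords ending at [t0] on the left; convexity
    places it below those of the chords on the right. At [t0 = 0] the slope [0] works by
    monotonicity. *)
Lemma orlicz_support_line t0 : 0 <= t0 ->
  exists s, forall t, 0 <= t -> Phi t0 + s * (t - t0) <= Phi t.
Proof.
rewrite le_eqVlt => /predU1P[<-|t0p].
  by exists 0 => t tp; rewrite mul0r addr0; exact: (orlicz_homo orlPhi).
pose S := [set (Phi t0 - Phi t) / (t0 - t) | t in [set t | 0 <= t < t0]].
have slopes t u : 0 <= t < t0 -> t0 < u ->
    (Phi t0 - Phi t) / (t0 - t) <= (Phi u - Phi t0) / (u - t0).
  move=> /andP[t0' tt0] t0u.
  have [_ _ conv _ _] := orlPhi.
  have ut : 0 < u - t by lra.
  have t0t : 0 < t0 - t by lra.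
  have ut0 : 0 < u - t0 by lra.
  have c0 : 0 <= (u - t0) / (u - t) by exact: divr_ge0 (ltW ut0) (ltW ut).
  have c1 : (u - t0) / (u - t) <= 1 by rewrite ler_pdivrMr// mul1r; lra.
  have := conv t u _ t0' (ltW (lt_trans t0p t0u)) c0 c1.
  have -> : (u - t0) / (u - t) * t + (1 - (u - t0) / (u - t)) * u = t0.
    by field; rewrite gt_eqF.
  have -> : (u - t0) / (u - t) * Phi t + (1 - (u - t0) / (u - t)) * Phi u =
      ((u - t0) * Phi t + (t0 - t) * Phi u) / (u - t) by field; rewrite gt_eqF.
  rewrite ler_pdivlMr// => h.
  by rewrite ler_pdivrMr// mulrAC ler_pdivlMr//; lra.
have S0 : S !=set0 by exists ((Phi t0 - Phi 0) / (t0 - 0)), 0 => //=; rewrite lexx.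
have Sub u : t0 < u -> ubound S ((Phi u - Phi t0) / (u - t0)).
  by move=> t0u _ [t t01 <-]; exact: slopes.
exists (sup S) => t tp; have [tt0|t0t|->] := ltgtP t t0.
- have : (Phi t0 - Phi t) / (t0 - t) <= sup S.
    apply: ub_le_sup; last by exists t => //=; rewrite tp.
    by exists ((Phi (t0 + 1) - Phi t0) / (t0 + 1 - t0)); apply: Sub; rewrite ltrDl.
  by rewrite ler_pdivrMr ?subr_gt0//; lra.
- have : sup S <= (Phi t - Phi t0) / (t - t0) by apply: ge_sup => //; exact: Sub.
  by rewrite ler_pdivlMr ?subr_gt0//; lra.
- by rewrite subrr mulr0 addr0.
Qed.

(** Integrate over [A] the supporting line at the mean of [|X| / l]; then [|mean X|] is at most the
    mean of [|X|], and [Phi] is monotone. *)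
Lemma orlicz_jensen (A : set T) (X : T -> R) (l : R) : measurable A -> (0 < P A)%E -> 0 < l ->
  LOrlicz P Phi X -> (modular P Phi X l < +oo)%E ->
  ((Phi (`|cell_mean P A X| / l))%:E * P A <= \int[P]_(x in A) (Phi (`|X x| / l))%:E)%E.
Proof.
move=> mA A0 l0 LX Xl; have a0 := fine_prob_gt0 mA A0.
have mX := LOrlicz_measurable LX.
have iX : P.-integrable A (EFin \o X).
  by apply: integrableS (LOrlicz_integrable orlPhi LX).
have iaX : P.-integrable A (EFin \o (fun x => `|X x|)) by exact: integrable_abse iX.
have iPhi : P.-integrable A (EFin \o (fun x => Phi (`|X x| / l))).
  by apply: integrableS (modular_integrable orlPhi l0 mX Xl).
pose t0 := cell_mean P A (fun x => `|X x|) / l.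
have t00 : 0 <= t0.
  by rewrite divr_ge0 ?(ltW l0)// divr_ge0 ?(ltW a0)//; apply: Rintegral_ge0.
have [s sP] := orlicz_support_line t00.
have isl : P.-integrable A (EFin \o (fun x => s / l * `|X x|)).
  rewrite (_ : EFin \o _ = (fun x => (s / l)%:E * (`|X x|)%:E)%E); first exact: integrableZl.
  by apply/funext => x /=; rewrite EFinM.
have icst c : P.-integrable A (EFin \o cst c) by exact: finite_measure_integrable_cst.
have key : Phi t0 * fine (P A) <= \int[P]_(x in A) Phi (`|X x| / l).
  have -> : Phi t0 * fine (P A) =
      \int[P]_(x in A) (s / l * `|X x| + cst (Phi t0 - s * t0) x).
    rewrite (RintegralD mA isl (icst _)) RintegralZl// Rintegral_cst//.
    by rewrite /t0 /cell_mean; field; rewrite !gt_eqF.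
  apply: le_Rintegral => //.
    rewrite (_ : EFin \o _ = (fun x => (s / l * `|X x|)%:E + (Phi t0 - s * t0)%:E)%E).
      by apply: integrableD => //; exact: icst.
    by apply/funext => x /=; rewrite EFinD.
  move=> x Ax /=; have := sP (`|X x| / l); rewrite divr_ge0 ?(ltW l0)// => /(_ isT).
  by rewrite mulrBr mulrA [s * _ / _]mulrAC; lra.
have PAfin : P A \is a fin_num by exact: fin_num_measure.
have -> : (\int[P]_(x in A) (Phi (`|X x| / l))%:E)%E = (\int[P]_(x in A) Phi (`|X x| / l))%:E.
  by rewrite fineK//; exact: integrable_fin_num.
rewrite -[in leLHS](fineK PAfin) -EFinM lee_fin; apply: le_trans key.
rewrite ler_pM2r//; apply: (orlicz_homo orlPhi); first by rewrite divr_ge0// ltW.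
rewrite ler_pM2r ?invr_gt0// /cell_mean normrM normfV (gtr0_norm a0).
by rewrite ler_pM2r ?invr_gt0//; exact: le_normr_Rintegral.
Qed.

(** Phrased with [convex_funs] so that [convex_funs_average] carries the bound to an average of
    copies. *)
Lemma modular_convex (l e : R) : 0 < l ->
  convex_funs [set X : T -> R | measurable_fun setT X /\ (modular P Phi X l <= e%:E)%E].
Proof.
move=> l0 X Y t [mX Xe] [mY Ye] t0 t1.
have mtX : measurable_fun setT (fun x => t * X x) by exact: measurable_funM.
have mtY : measurable_fun setT (fun x => (1 - t) * Y x) by exact: measurable_funM.
have t1' : 0 <= 1 - t by rewrite subr_ge0.
split; first exact: measurable_funD.
have pos (Z : T -> R) x : 0 <= `|Z x| / l by rewrite divr_ge0// ltW.
have mZ c (Z : T -> R) : measurable_fun setT Z ->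
    measurable_fun setT (fun x => c%:E * (Phi (`|Z x| / l))%:E)%E.
  by move=> mZ; apply: measurable_funeM; exact: measurable_orlicz.
apply: (@le_trans _ _ (t%:E * modular P Phi X l + (1 - t)%:E * modular P Phi Y l)%E); last first.
  apply: (@le_trans _ _ (t%:E * e%:E + (1 - t)%:E * e%:E)%E).
    by apply: leeD; apply: lee_wpmul2l => //; rewrite lee_fin.
  by rewrite -!EFinM -EFinD lee_fin; lra.
rewrite /modular -!ge0_integralZl//; try exact: measurable_orlicz;
  try by move=> x _; rewrite lee_fin (orlicz_ge0 orlPhi) ?pos.
rewrite -ge0_integralD//; try exact: mZ;
  try by move=> x _; rewrite mule_ge0// lee_fin (orlicz_ge0 orlPhi) ?pos.
apply: ge0_le_integral => //.
- by move=> x _; rewrite lee_fin (orlicz_ge0 orlPhi)// divr_ge0// ltW.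
- by apply: measurable_orlicz => //; exact: measurable_funD.
- by apply: emeasurable_funD; exact: mZ.
move=> x _; rewrite -!EFinM -EFinD lee_fin.
have [_ _ conv _ _] := orlPhi.
apply: le_trans (conv _ _ _ (pos X x) (pos Y x) t0 t1).
apply: (orlicz_homo orlPhi); first by rewrite divr_ge0// ltW.
rewrite !mulrA -mulrDl ler_pM2r ?invr_gt0//.
by apply: (le_trans (ler_normD _ _)); rewrite !normrM (ger0_norm t0) (ger0_norm t1').
Qed.

(** Dominated convergence with dominating function [Phi (|X| / l)], hence available only at a scale
    where the modular is finite. *)
Lemma modular_tail (X : T -> R) (l e : R) : 0 < l -> measurable_fun setT X ->
  (modular P Phi X l < +oo)%E -> 0 < e ->
  exists K : R, 0 < K /\ (modular P Phi (fun x => if (K < `|X x|)%R then X x else 0%R) l <= e%:E)%E.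
Proof.
move=> l0 mX Xl e0; have [Phi0 _ _ _ _] := orlPhi.
pose f n x := if n.+1%:R < `|X x| then X x else 0.
have mf n : measurable_fun setT (f n).
  by apply: measurable_fun_ifT => //; apply: measurable_fun_ltr => //; exact: measurableT_comp.
have iPhi := modular_integrable orlPhi l0 mX Xl.
have [||||_ _] := @dominated_convergence _ _ _ P setT measurableT
  (fun n x => (Phi (`|f n x| / l))%:E) (cst 0%E) (fun x => (Phi (`|X x| / l))%:E) _ _ _ iPhi.
- by move=> n; exact: measurable_orlicz.
- exact: measurable_cst.
- apply: aeW => x _; apply: cvg_near_cst; exists (Num.truncn `|X x|) => // n /= nX.
  rewrite /f ifF ?normr0 ?mul0r ?Phi0//; apply/negbTE; rewrite -leNgt.
  by rewrite (le_trans (ltW (truncnS_gt _)))// ler_nat ltnS.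
- apply: aeW => x n _; rewrite gee0_abs ?lee_fin ?(orlicz_ge0 orlPhi) ?divr_ge0 ?(ltW l0)//.
  rewrite (orlicz_homo orlPhi) ?divr_ge0 ?(ltW l0)// ler_pM2r ?invr_gt0// /f.
  by case: ifP => //; rewrite normr0.
rewrite integral_cst// mul0e => cv.
have e0' : (0 < e%:E)%E by rewrite lte_fin.
have [n _ /(_ n (leqnn n)) /= /ltW h] := cv _ (open_ereal_lt' e0').
by exists n.+1%:R; split.
Qed.

End ModularEstimates.

(** * Averaging in closed convex law-invariant sets *)

Section CellAveraging.
Context {d : measure_display} {T : measurableType d} {R : realType}.
Variables (P : probability T R) (Phi : R -> R).
Hypothesis orlPhi : orlicz_function Phi.

Lemma measurable_fun_if_in (A : set T) (f g : T -> R) : measurable A ->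
  measurable_fun setT f -> measurable_fun setT g ->
  measurable_fun setT (fun x => if x \in A then f x else g x).
Proof.
move=> mA mf mg _ B mB; rewrite setTI.
have mpre (h : T -> R) : measurable_fun setT h -> measurable (h @^-1` B).
  by move=> mh; rewrite -[X in measurable X]setTI; exact: mh.
rewrite (_ : _ @^-1` B = (A `&` f @^-1` B) `|` (~` A `&` g @^-1` B)).
  by apply: measurableU; apply: measurableI => //; [exact: mpre|exact: measurableC|exact: mpre].
apply/seteqP; split => x /=.
  by case: ifPn => [/set_mem|/negP nA]; [left|right; split => // /mem_set].
by move=> [[/mem_set -> //]|[nA]]; rewrite memNset.
Qed.

Lemma LOrlicz_if_in (A : set T) (f g : T -> R) : measurable A ->
  LOrlicz P Phi f -> LOrlicz P Phi g -> LOrlicz P Phi (fun x => if x \in A then f x else g x).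
Proof.
move=> mA Lf Lg; have [mf mg] := (LOrlicz_measurable Lf, LOrlicz_measurable Lg).
have Labs h : LOrlicz P Phi h -> LOrlicz P Phi (fun x => `|h x|).
  move=> Lh; apply: (le_LOrlicz orlPhi _ Lh).
    by apply: measurableT_comp => //; exact: LOrlicz_measurable Lh.
  by apply: aeW => x; rewrite normr_id.
apply: (le_LOrlicz orlPhi _ (LOrliczD orlPhi (Labs _ Lf) (Labs _ Lg))).
  exact: measurable_fun_if_in.
apply: aeW => x /=; rewrite [leRHS]ger0_norm ?addr_ge0//.
by case: ifP => _; [rewrite lerDl|rewrite lerDr].
Qed.

Lemma modular_cst (c l : R) : modular P Phi (cst c) l = (Phi (`|c| / l))%:E.
Proof.
rewrite /modular/= integral_cst//.
by transitivity ((Phi (`|c| / l))%:E * 1)%E; [congr (_ * _)%E; exact: probability_setT|rewrite mule1].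
Qed.

Lemma modular_in (A : set T) (X : T -> R) (l : R) :
  measurable A ->
  modular P Phi (fun x => if x \in A then X x else 0) l = (\int[P]_(x in A) (Phi (`|X x| / l))%:E)%E.
Proof.
move=> mA; have [Phi0 _ _ _ _] := orlPhi.
rewrite integral_mkcond; apply: eq_integral => x _; rewrite /patch.
by case: ifP => //; rewrite normr0 mul0r Phi0.
Qed.

Lemma modular_cell_mean (A : set T) (X : T -> R) (l : R) : measurable A -> 0 < l ->
  LOrlicz P Phi X -> (modular P Phi X l < +oo)%E ->
  (modular P Phi (fun x => if x \in A then cell_mean P A X else 0%R) l <=
   modular P Phi (fun x => if x \in A then X x else 0%R) l)%E.
Proof.
move=> mA l0 LX Xl; have [Phi0 _ _ _ _] := orlPhi.
have [A0|A0] := ltP 0%E (P A).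
  rewrite modular_in// modular_in// integral_cst//; exact: orlicz_jensen.
have PA0 : fine (P A) = 0.
  suff -> : P A = 0%E by [].
  by apply/eqP; rewrite eq_le A0/=; exact: measure_ge0.
rewrite (_ : (fun x => if x \in A then _ else _) = cst 0).
  rewrite modular_cst normr0 mul0r Phi0; apply: modular_ge0 => //.
by apply/funext => x; rewrite /cell_mean PA0 invr0 mulr0 if_same.
Qed.

Lemma same_law_modular (X Y : T -> R) (l : R) : 0 < l -> measurable_fun setT X ->
  measurable_fun setT Y -> same_law P X Y -> modular P Phi X l = modular P Phi Y l.
Proof.
move=> l0 mX mY XY.
apply: (same_law_ge0_integral (h := fun r => (Phi (`|r| / l))%:E)) => //.
  exact: (measurable_orlicz orlPhi measurableT l0 (@measurable_id _ _ setT)).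
by move=> r; rewrite lee_fin (orlicz_ge0 orlPhi)// divr_ge0// ltW.
Qed.

Lemma same_law_LOrlicz (X Y : T -> R) : measurable_fun setT X -> same_law P X Y ->
  LOrlicz P Phi Y -> LOrlicz P Phi X.
Proof.
move=> mX XY [mY [l [l0 Yl]]]; split => //; exists l; split => //.
by rewrite (same_law_modular l0 mX mY).
Qed.

(** The integrals over the whole space agree by equality of laws, those over the complement of [A]
    because the functions coincide there; subtract. *)
Lemma same_law_cell (A : set T) (X Y : T -> R) : measurable A -> LOrlicz P Phi X ->
  LOrlicz P Phi Y -> same_law P X Y -> (forall x, ~ A x -> X x = Y x) ->
  \int[P]_(x in A) X x = \int[P]_(x in A) Y x.
Proof.
move=> mA LX LY XY XYA.
have := same_law_Rintegral (LOrlicz_measurable LX) (LOrlicz_measurable LY) XY.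
have split_ Z : LOrlicz P Phi Z ->
    \int[P]_x Z x = \int[P]_(x in A) Z x + \int[P]_(x in ~` A) Z x.
  move=> LZ; rewrite -Rintegral_setU ?setUv//; first exact: measurableC.
    exact: LOrlicz_integrable LZ.
  by apply/disj_setPS => x [].
rewrite !split_// (_ : \int[P]_(x in ~` A) X x = \int[P]_(x in ~` A) Y x); last first.
  by apply: eq_Rintegral => x /set_mem nA; exact: XYA.
exact: addIr.
Qed.

(* Compare the [j]-th term on the left with the [j+1]-st on the right. *)
Lemma riemann_sum_osc (g : R -> R) (K : R) n (w w' : R) :
  (forall s t, 0 < s -> s <= t -> t < 1 -> g s <= g t) -> (forall s, `|g s| <= K) ->
  0 < w < 1 -> 0 < w' < 1 ->
  \sum_(j < n.+1) g ((j%:R + w) / n.+1%:R) <= \sum_(j < n.+1) g ((j%:R + w') / n.+1%:R) + 2 * K.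
Proof.
move=> g_homo gK /andP[w0 w1] /andP[w0' w1'].
rewrite big_ord_recr [in leRHS]big_ord_recl/=.
have gub s : g s <= K by rewrite (le_trans (ler_norm _)).
have glb s : - K <= g s by have := gK s; rewrite ler_norml => /andP[].
have h : \sum_(j < n) g ((j%:R + w) / n.+1%:R) <=
    \sum_(j < n) g (((bump 0 j)%:R + w') / n.+1%:R).
  apply: ler_sum => j _; apply: g_homo.
  - by rewrite divr_gt0// ltr_wpDl.
  - rewrite ler_pM2r ?invr_gt0// /bump/= add1n -natr1 -addrA lerD2l.
    by rewrite (le_trans (ltW w1))// lerDl ltW.
  - rewrite ltr_pdivrMr// mul1r /bump/= add1n -[X in _ < X]natr1 ler_ltD// ler_nat.
    exact: ltn_ord.
have := gub ((n%:R + w) / n.+1%:R); have := glb ((0%:R + w') / n.+1%:R); lra.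
Qed.

(** Clamping, unlike replacing large values by [0], keeps a monotone function monotone, as
    [riemann_sum_osc] requires. *)
Definition clamp (K z : R) : R := Num.max (- K) (Num.min z K).

Lemma clamp_homo K s t : s <= t -> clamp K s <= clamp K t.
Proof.
by move=> st; rewrite /clamp ge_max !le_max lexx/= le_min !ge_min st lexx/= !orbT.
Qed.

Lemma clamp_norm K z : 0 <= K -> `|clamp K z| <= K.
Proof.
move=> K0; rewrite ler_norml /clamp le_max lexx/= ge_max ge_min lexx orbT andbT; lra.
Qed.

Lemma clampB_norm K z : 0 <= K -> `|z - clamp K z| <= `|if K < `|z| then z else 0|.
Proof.
move=> K0; rewrite /clamp; case: ifPn => [Kz|].
  have [z0|z0] := leP 0 z.
    rewrite ger0_norm// in Kz; rewrite (min_r (ltW Kz)) max_r; last lra.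
    by rewrite !ger0_norm//; lra.
  rewrite ltr0_norm// in Kz; rewrite min_l; last lra.
  by rewrite max_l; [rewrite !ler0_norm; lra|lra].
rewrite -leNgt ler_norml => /andP[zK Kz].
by rewrite min_l// max_r// subrr.
Qed.

Lemma measurable_clamp K (X : T -> R) : measurable_fun setT X ->
  measurable_fun setT (fun x => X x - clamp K (X x)).
Proof.
move=> mX; apply: measurable_funB => //; rewrite /clamp.
by apply: measurable_maxr => //; exact: measurable_minr.
Qed.

Hypothesis naP : nonatomic P.
Variable C : set (T -> R).
Hypothesis CL : C `<=` LOrlicz P Phi.
Hypothesis Cconv : convex_funs C.
Hypothesis Claw : forall X Y, C X -> LOrlicz P Phi Y -> same_law P Y X -> C Y.
(** Approximation at one scale is weaker than norm approximation, so this closedness is a strong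
    one; each application may pick its own scale. *)
Hypothesis Cclosed : forall X (l : R), LOrlicz P Phi X -> 0 < l ->
  (forall e : R, 0 < e -> exists2 X', C X' & (modular P Phi (X' \- X)%R l <= e%:E)%E) -> C X.

Lemma closed_ae X Y : C X -> LOrlicz P Phi Y -> {ae P, forall x, X x = Y x} -> C Y.
Proof.
move=> CX LY XY; have [Phi0 _ _ _ _] := orlPhi.
apply: (Cclosed LY ltr01) => e e0; exists X => //.
apply: (@le_trans _ _ (modular P Phi (cst 0) 1)).
  apply: le_modular => //.
    apply: measurable_funB; [exact: LOrlicz_measurable (CL CX)|exact: LOrlicz_measurable LY].
  by apply: filterS XY => x /= ->; rewrite subrr.
by rewrite modular_cst normr0 mul0r Phi0 lee_fin ltW.
Qed.

(* The copies [f k] of [X] have the law of [X]; on [A] they are obtained by a cyclic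
   shift of the pieces of a monotone rearrangement. Their average [X'] lies in [C], and on
   [A] it is the sum of the average [b] of the parts beyond the level [K], small in
   modular, and of a Riemann sum of a monotone function bounded by [K], which
   oscillates by at most [2 * K / n.+1]. *)
Lemma closed_cell_mean (A : set T) X : measurable A -> C X ->
  C (fun x => if x \in A then cell_mean P A X else X x).
Proof.
move=> mA CX; have LX := CL CX; have mX := LOrlicz_measurable LX.
set Y := (fun x => _).
have LY : LOrlicz P Phi Y by apply: LOrlicz_if_in => //; exact: LOrlicz_cst.
have [A0|A0] := ltP 0%E (P A); last first.
  apply: (closed_ae CX LY); exists A; split => //.
    by apply/eqP; rewrite eq_le; apply/andP; split => //; exact: measure_ge0.
  by move=> x /= XY; apply: contrapT => nA; apply: XY; rewrite /Y memNset.
have [_ [l [l0 Xl]]] := LX.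
have Xoo : (modular P Phi X l < +oo)%E by exact: le_lt_trans Xl (ltry 1).
have l20 : 0 < l * 2 by rewrite mulr_gt0.
(* The difference will be a sum of three terms, separated by two uses of [modularD]: two doublings
   of the scale, and a share [e / 3] for each term. *)
have l40 : 0 < l * 2 * 2 by rewrite mulr_gt0.
apply: (Cclosed LY l40) => e e0.
have e30 : 0 < e / 3 by rewrite divr_gt0.
have [K [K0 XK]] := modular_tail orlPhi l0 mX Xoo e30.
(* The oscillation [2 * K / n.+1] read at scale [l * 2] is [(K / l) / n.+1]; convexity bounds its
   [Phi] by [Phi (K / l) / n.+1], which this [n] makes at most [e / 3]. *)
pose n := Num.truncn (Phi (K / l) / (e / 3)).
have nP : (n.+1%:R)^-1 * Phi (K / l) <= e / 3.
  rewrite mulrC ler_pdivrMr// [_ * n.+1%:R]mulrC -ler_pdivrMr//; exact/ltW/truncnS_gt.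
have [I [V [q [V01 q_homo fP]]]] := ex_cyclic_copies naP n mA A0 mX.
pose f (k : 'I_n.+1) x := if x \in A then q (((I x + k)%R%:R + V x) / n.+1%:R) else X x.
have mf k : measurable_fun setT (f k) by case: (fP k).
have fX k : same_law P (f k) X by case: (fP k).
have Lf k : LOrlicz P Phi (f k) by exact: same_law_LOrlicz (fX k) LX.
have Cf k : C (f k) by exact: Claw (fX k).
pose X' x := (\sum_k f k x) / n.+1%:R.
have CX' : C X' by apply: convex_funs_average.
have LX' := CL CX'.
pose r z := z - clamp K z.
pose b x := (\sum_k r (f k x)) / n.+1%:R.
have [mb be] : measurable_fun setT b /\ (modular P Phi b l <= (e / 3)%:E)%E.
  apply: (convex_funs_average (modular_convex orlPhi l0)) => k; split.
    exact: measurable_clamp.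
  have rfX : same_law P (fun x => r (f k x)) (fun x => r (X x)).
    move=> B mB; have mrB : measurable (r @^-1` B).
      rewrite -[Z in measurable Z]setTI; have mr : measurable_fun setT r.
        apply: measurable_funB => //; rewrite /clamp.
        by apply: measurable_maxr => //; exact: measurable_minr.
      exact: mr.
    exact: (fX k _ mrB).
  rewrite (same_law_modular l0 _ _ rfX); [|exact: measurable_clamp|exact: measurable_clamp].
  apply: le_trans XK; apply: le_modular => //; first exact: measurable_clamp.
    apply: measurable_fun_ifT => //; apply: measurable_fun_ltr => //.
    exact: measurableT_comp.
  by apply: aeW => x; apply: clampB_norm; exact: ltW.
have boo : (modular P Phi b l < +oo)%E by exact: le_lt_trans be (ltry _).
have Lb : LOrlicz P Phi b by exact: (modular_LOrlicz orlPhi mb l0).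
have iA Z : LOrlicz P Phi Z -> P.-integrable A (EFin \o Z).
  by move=> LZ; apply: integrableS (LOrlicz_integrable orlPhi LZ).
have meanX' : cell_mean P A X' = cell_mean P A X.
  congr (_ / _).
  have := @convex_funs_average _ _ _
    [set Z : T -> R | LOrlicz P Phi Z /\ \int[P]_(x in A) Z x = \int[P]_(x in A) X x] n f.
  case=> //; last first.
    by move=> k; split => //; apply: same_law_cell => // x nA; rewrite /f memNset.
  move=> Z1 Z2 t [LZ1 Z1X] [LZ2 Z2X] t0 t1; split.
    by apply: LOrliczD => //; exact: LOrliczZ.
  rewrite RintegralD//; [|exact/iA/LOrliczZ|exact/iA/LOrliczZ].
  by rewrite !RintegralZl ?Z1X ?Z2X//; [ring|exact: iA|exact: iA].
(* Removing [b] leaves the average of the clamped copies. Reindexing by [k] to [I x + k] absorbs the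
   index of the piece, so only [V x] distinguishes two points of [A]. *)
have osc x y : A x -> A y -> `|(X' x - b x) - (X' y - b y)| <= 2 * K / n.+1%:R.
  have WE z : A z -> X' z - b z =
      (\sum_(j < n.+1) clamp K (q ((j%:R + V z) / n.+1%:R))) / n.+1%:R.
    move=> Az; rewrite /X' /b -mulrBl -sumrB; congr (_ / _).
    rewrite [RHS](reindex_inj (addrI (I z))); apply: eq_bigr => k _.
    by rewrite /r subKr /f mem_set.
  move=> Ax Ay; rewrite !WE// -mulrBl normrM [`|_^-1|]ger0_norm ?invr_ge0//.
  rewrite ler_pM2r ?invr_gt0//.
  have W z z' := @riemann_sum_osc (fun u => clamp K (q u)) K n (V z) (V z')
    (fun s t s0 st t1 => clamp_homo K (q_homo s t s0 st t1)) (fun s => clamp_norm (q s) (ltW K0))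
    (V01 z) (V01 z').
  by rewrite ler_norml lerBlDl W andbT; have := W y x; lra.
have iXb : P.-integrable A (EFin \o (X' \- b)).
  apply: iA; rewrite (_ : X' \- b = X' \+ (fun x => -1 * b x)).
    by apply: LOrliczD => //; exact: LOrliczZ.
  by apply/funext => x /=; rewrite mulN1r.
have mX' := LOrlicz_measurable LX'.
pose h x := (X' \- b) x - cell_mean P A (X' \- b).
have hK x : A x -> `|h x| <= 2 * K / n.+1%:R by apply: cell_mean_osc.
have mh : measurable_fun setT h.
  by apply: measurable_funB => //; exact: measurable_funB.
pose H x := if x \in A then h x else 0.
pose B x := if x \in A then b x else 0.
pose D x := if x \in A then - cell_mean P A b else 0.
have mH : measurable_fun setT H by exact: measurable_fun_if_in.
have mB : measurable_fun setT B by exact: measurable_fun_if_in.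
have mD : measurable_fun setT D by exact: measurable_fun_if_in.
exists X' => //.
(* On [A], the mean of [X] is that of [X'], hence the mean of [X' \- b] plus that of [b]. Off [A]
   every copy equals [X], and the difference vanishes. *)
have -> : X' \- Y = H \+ (B \+ D).
  apply/funext => x /=; rewrite /Y /H /B /D; case: ifPn => xA.
    by rewrite /h cell_meanB//; [rewrite meanX'/=; ring|exact: iA|exact: iA].
  rewrite !addr0 /X'; under eq_bigr do rewrite /f (negbTE xA).
  by rewrite sumr_const card_ord -[_ *+ _]mulr_natr mulfK ?subrr.
have mBD : measurable_fun setT (B \+ D) by exact: measurable_funD.
apply: (le_trans (modularD P orlPhi l20 mH mBD)).
have -> : e = e / 3 + (e / 3 + e / 3) by field.
rewrite EFinD; apply: leeD.
  apply: (@le_trans _ _ (modular P Phi (cst (2 * K / n.+1%:R)) (l * 2))).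
    apply: le_modular => //; apply: aeW => x; rewrite /H /=.
    have K2 : 0 <= 2 * K / n.+1%:R by rewrite divr_ge0// mulr_ge0// ltW.
    rewrite (ger0_norm K2); case: ifPn => [/set_mem /hK//|_].
    by rewrite normr0.
  rewrite modular_cst lee_fin ger0_norm; last by rewrite divr_ge0// mulr_ge0// ltW.
  apply: le_trans nP; rewrite (_ : 2 * K / n.+1%:R / (l * 2) = n.+1%:R^-1 * (K / l)).
    apply: (orlicz_scale orlPhi); first by rewrite divr_ge0// ltW.
      by rewrite invr_ge0.
    by rewrite invf_le1// ler1n.
  by field; rewrite gt_eqF//= pnatr_eq0.
apply: (le_trans (modularD P orlPhi l0 mB mD)).
have Bb : (modular P Phi B l <= (e / 3)%:E)%E.
  apply: le_trans be; apply: le_modular => //; apply: aeW => x; rewrite /B.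
  by case: ifP => // _; rewrite normr0.
rewrite EFinD; apply: leeD => //; apply: le_trans Bb.
apply: le_trans (modular_cell_mean mA l0 Lb boo).
apply: le_modular => //; first exact: measurable_fun_if_in.
by apply: aeW => x; rewrite /D; case: ifP => // _; rewrite normrN.
Qed.

End CellAveraging.

(** * Conditional means over finite partitions *)

Section FinitePartitions.
Context {d : measure_display} {T : measurableType d} {R : realType}.
Variables (P : probability T R) (Phi : R -> R).
Hypothesis orlPhi : orlicz_function Phi.
Hypothesis naP : nonatomic P.
Variable C : set (T -> R).
Hypothesis CL : C `<=` LOrlicz P Phi.
Hypothesis Cconv : convex_funs C.
Hypothesis Claw : forall X Y, C X -> LOrlicz P Phi Y -> same_law P Y X -> C Y.
Hypothesis Cclosed : forall X (l : R), LOrlicz P Phi X -> 0 < l ->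
  (forall e : R, 0 < e -> exists2 X', C X' & (modular P Phi (X' \- X)%R l <= e%:E)%E) -> C X.

(** The cells are averaged one after the other: averaging over cell [j] leaves the other cells
    alone, and [F j] still equals [X] on cell [j]. *)
Lemma closed_partition_mean (kappa : T -> nat) X N :
  (forall i, measurable (kappa @^-1` [set i])) -> C X -> (forall x, (kappa x < N)%N) ->
  C (fun x => cell_mean P (kappa @^-1` [set kappa x]) X).
Proof.
move=> mk CX kN.
pose F j x := if (kappa x < j)%N then cell_mean P (kappa @^-1` [set kappa x]) X else X x.
suff CF j : C (F j).
  rewrite (_ : (fun x => _) = F N); first exact: CF.
  by apply/funext => x; rewrite /F kN.
elim: j => [|j IH]; first by rewrite (_ : F 0%N = X).
rewrite (_ : F j.+1 = (fun x => if x \in kappa @^-1` [set j]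
    then cell_mean P (kappa @^-1` [set j]) (F j) else F j x)).
  exact: (closed_cell_mean orlPhi naP CL Cconv Claw Cclosed).
apply/funext => x; case: ifPn => [/set_mem /= kx|/negP nk].
  rewrite /F kx ltnSn /cell_mean; congr (_ / _).
  by apply: eq_Rintegral => y /set_mem /= ->; rewrite ltnn.
rewrite /F ltnS leq_eqVlt; case: eqP => //= kx.
by exfalso; apply: nk; exact/mem_set.
Qed.

(** Applied to the measures of the cells, it lets closeness of integrals be divided into closeness
    of means on all non-null cells at once. *)
Lemma ex_lower_bound_pos (p : nat -> R) N :
  exists2 e, 0 < e & forall i, (i < N)%N -> 0 < p i -> e <= p i.
Proof.
elim: N => [|N [e e0 ep]]; first by exists 1.
have [pN|pN] := leP (p N) 0.
  exists e => // i; rewrite ltnS leq_eqVlt => /predU1P[->|]; last exact: ep.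
  by rewrite ltNge pN.
exists (Num.min e (p N)); first by rewrite lt_min e0.
move=> i; rewrite ltnS leq_eqVlt ge_min => /predU1P[->|iN p0]; first by rewrite lexx orbT.
by rewrite ep.
Qed.

Lemma ae_positive_cell (kappa : T -> nat) : (forall i, measurable (kappa @^-1` [set i])) ->
  {ae P, forall x, (0 < P (kappa @^-1` [set kappa x]))%E}.
Proof.
move=> mk.
have : P.-negligible (\bigcup_i (if (0 < P (kappa @^-1` [set i]))%E then set0 else kappa @^-1` [set i])).
  apply: negligible_bigcup => i; case: ifPn => [_|]; first exact: negligible_set0.
  rewrite -leNgt => Pi; exists (kappa @^-1` [set i]); split => //.
  by apply/eqP; rewrite eq_le; apply/andP; split => //; exact: measure_ge0.
apply: negligibleS => x /= nx; exists (kappa x) => //.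
by case: ifPn => // px; apply: nx.
Qed.

(* Cell [0] of the partition is the tail [K < |X|], where Jensen's inequality controls
   the mean of [X]; on each other cell [X] oscillates by at most [eta]. *)
Lemma closed_weak_approx X : LOrlicz P Phi X ->
  (forall N (kappa : T -> nat) (e : R), (forall i, measurable (kappa @^-1` [set i])) -> 0 < e ->
    exists2 Z, C Z & forall i, (i < N)%N ->
      `|\int[P]_(x in kappa @^-1` [set i]) Z x - \int[P]_(x in kappa @^-1` [set i]) X x| < e) ->
  C X.
Proof.
move=> LX approx; have mX := LOrlicz_measurable LX.
have [_ [l [l0 Xl]]] := LX.
have Xoo : (modular P Phi X l < +oo)%E by exact: le_lt_trans Xl (ltry 1).
have l20 : 0 < l * 2 by rewrite mulr_gt0.
have l40 : 0 < l * 2 * 2 by rewrite mulr_gt0.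
apply: (Cclosed LX l40) => e e0.
have e30 : 0 < e / 3 by rewrite divr_gt0.
have [K [K0 XK]] := modular_tail orlPhi l0 mX Xoo e30.
have P10 : 0 < Phi 1 by exact: (orlicz_gt0 orlPhi).
(* Convexity gives [Phi s <= s * Phi 1 <= e / 3]. Slices of width [eta = l * s] lead to an error of
   at most [2 * eta], which at scale [l * 2] is exactly [s]. *)
pose s := Num.min 1 (e / 3 / Phi 1).
have s0 : 0 < s by rewrite lt_min ltr01 divr_gt0.
have sP : Phi s <= e / 3.
  rewrite -[s]mulr1; apply: (le_trans (orlicz_scale orlPhi ler01 (ltW s0) _)).
    by rewrite /s ge_min lexx.
  by rewrite -ler_pdivlMr// /s ge_min lexx orbT.
pose eta := l * s.
have eta0 : 0 < eta by rewrite mulr_gt0.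
pose a x := (X x + K) / eta.
pose kappa x := if K < `|X x| then 0%N else (Num.truncn (a x)).+1.
(* Off the tail [a x] is between [0] and [2 * K / eta]; index [0] is taken by the tail, so slices
   are numbered from [1] to [N - 1]. *)
pose N := (Num.truncn (2 * K / eta)).+2.
have a0 x : `|X x| <= K -> 0 <= a x.
  by rewrite ler_norml => /andP[KX _]; rewrite divr_ge0 ?(ltW eta0)//; lra.
have kN x : (kappa x < N)%N.
  rewrite /kappa; case: ifPn => //; rewrite -leNgt => XK'.
  rewrite ltnS ltnS truncn_ge_nat; last by rewrite divr_ge0 ?mulr_ge0// ltW.
  apply: (@le_trans _ _ (a x)); first by rewrite truncn_le a0.
  by move: XK'; rewrite ler_norml => /andP[_ XK']; rewrite ler_pM2r ?invr_gt0//; lra.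
have mset (b : T -> bool) : measurable_fun setT b -> measurable [set x | b x].
  move=> mb; rewrite (_ : [set x | b x] = b @^-1` [set true]).
    by rewrite -[Z in measurable Z]setTI; exact: mb.
  by apply/seteqP; split => x /=.
have maX : measurable_fun setT (fun x => `|X x|) by exact: measurableT_comp.
have ma : measurable_fun setT a by apply: measurable_funM => //; exact: measurable_funD.
have cell0 : kappa @^-1` [set 0%N] = [set x | K < `|X x|].
  by apply/seteqP; split => x /=; rewrite /kappa; case: ifPn.
have cellS i : kappa @^-1` [set i.+1] =
    [set x | (`|X x| <= K) && ((i%:R <= a x) && (a x < i.+1%:R))].
  apply/seteqP; split => x /=; rewrite /kappa; case: ifPn => //; rewrite -?leNgt.
  - by move=> XK' [<-]; rewrite XK' truncn_itv ?a0.
  - by rewrite ltNge => /negbTE ->.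
  - by move=> XK' /andP[_ /truncn_def ->].
have mk i : measurable (kappa @^-1` [set i]).
  case: i => [|i]; first by rewrite cell0; apply: mset; exact: measurable_fun_ltr.
  rewrite cellS; apply: mset; apply: measurable_and; first exact: measurable_fun_ler.
  by apply: measurable_and; [exact: measurable_fun_ler|exact: measurable_fun_ltr].
have [del del0 delP] := ex_lower_bound_pos (fun i => fine (P (kappa @^-1` [set i]))) N.
have [Z CZ ZX] := approx N kappa (eta * del) mk (mulr_gt0 eta0 del0).
have LZ := CL CZ.
pose cell x := kappa @^-1` [set kappa x].
pose X' x := cell_mean P (cell x) Z.
have CX' : C X' by exact: closed_partition_mean mk CZ kN.
have mX' := LOrlicz_measurable (CL CX').
have ZXmean x : (0 < P (cell x))%E -> `|cell_mean P (cell x) Z - cell_mean P (cell x) X| <= eta.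
  move=> /(fine_prob_gt0 (mk _)) p0; rewrite /cell_mean -mulrBl normrM normfV (gtr0_norm p0).
  rewrite ler_pdivrMr//; apply: (le_trans (ltW (ZX _ (kN x)))).
  by rewrite ler_pM2l//; apply: delP.
have Xmean x : (0 < P (cell x))%E -> `|X x| <= K -> `|cell_mean P (cell x) X - X x| <= eta.
  move=> p0 xK; rewrite distrC; apply: cell_mean_osc => //; first exact: mk.
    by apply: integrableS (LOrlicz_integrable orlPhi LX) => //; exact: mk.
  have kx : kappa x = (Num.truncn (a x)).+1 by rewrite /kappa ltNge xK.
  move=> y z; rewrite /cell kx cellS => /= /andP[_ /andP[iy yi]] /andP[_ /andP[iz zi]].
  have aB : X y - X z = (a y - a z) * eta by rewrite /a; field; rewrite gt_eqF.
  rewrite aB normrM (gtr0_norm eta0) -[leRHS]mul1r ler_pM2r// ler_norml.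
  by move: yi zi; rewrite -natr1; lra.
pose A := kappa @^-1` [set 0%N].
pose G1 x := if x \in A then cell_mean P A Z - cell_mean P A X else X' x - X x.
pose G2 x := if x \in A then - X x else 0.
pose G3 x := if x \in A then cell_mean P A X else 0.
have mA : measurable A by exact: mk.
have mG1 : measurable_fun setT G1 by apply: measurable_fun_if_in => //; exact: measurable_funB.
have mG2 : measurable_fun setT G2 by apply: measurable_fun_if_in => //; exact: measurableT_comp.
have mG3 : measurable_fun setT G3 by exact: measurable_fun_if_in.
exists X' => //.
have -> : X' \- X = G1 \+ (G2 \+ G3).
  apply/funext => x /=; rewrite /G1 /G2 /G3; case: ifPn => [/set_mem /= kx|_]; last by rewrite !addr0.
  by rewrite /X' /cell kx; ring.
have mG23 : measurable_fun setT (G2 \+ G3) by exact: measurable_funD.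
apply: (le_trans (modularD P orlPhi l20 mG1 mG23)).
have -> : e = e / 3 + (e / 3 + e / 3) by field.
rewrite EFinD; apply: leeD.
  apply: (@le_trans _ _ (modular P Phi (cst (2 * eta)) (l * 2))).
    apply: le_modular => //; apply: filterS (ae_positive_cell mk) => x p0; rewrite /G1 /=.
    have eta2 : 0 <= 2 * eta by rewrite mulr_ge0// ltW.
    rewrite (ger0_norm eta2); case: ifPn => [/set_mem /= kx|/negP nA].
      have := ZXmean x p0; rewrite /cell kx => h; apply: (le_trans h).
      by rewrite ler_peMl ?(ltW eta0)// ler1n.
    have xK : `|X x| <= K by rewrite leNgt; apply/negP => h; apply: nA; rewrite /A cell0; exact/mem_set.
    have := ZXmean x p0; have := Xmean x p0 xK; rewrite /X' !ler_norml; lra.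
  rewrite modular_cst lee_fin ger0_norm; last by rewrite mulr_ge0// ltW.
  by rewrite (_ : 2 * eta / (l * 2) = s)// /eta; field; rewrite gt_eqF.
apply: (le_trans (modularD P orlPhi l0 mG2 mG3)).
have tail : (modular P Phi (fun x => if x \in A then X x else 0%R) l <= (e / 3)%:E)%E.
  rewrite (_ : (fun x => _) = (fun x => if K < `|X x| then X x else 0))//.
  apply/funext => x; case: ifPn => [/set_mem|/negP nA]; first by rewrite /A cell0 /= => ->.
  by case: ifPn => // h; exfalso; apply: nA; rewrite /A cell0; exact/mem_set.
rewrite EFinD; apply: leeD; last exact: le_trans (modular_cell_mean orlPhi mA l0 LX Xoo) tail.
apply: le_trans tail; apply: le_modular => //; first exact: measurable_fun_if_in.
by apply: aeW => x; rewrite /G2; case: ifP => // _; rewrite normrN.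
Qed.

End FinitePartitions.

(** * Fatou property and closedness *)

Section FatouClosed.
Context {d : measure_display} {T : measurableType d} {R : realType}.
Variables (P : probability T R) (Phi : R -> R).
Hypothesis orlPhi : orlicz_function Phi.

Lemma limn_einf_le (u : nat -> \bar R) c : (forall n, (u n <= c)%E) -> (limn_einf u <= c)%E.
Proof.
move=> uc; rewrite limn_einf_lim; apply: lime_le; first exact: is_cvg_einfs.
apply: nearW => n; apply: le_trans (uc n).
by apply: ereal_inf_lbound; exists n => //=.
Qed.

Lemma le_limn_einf (u : nat -> \bar R) c :
  (\forall n \near \oo, (c <= u n)%E) -> (c <= limn_einf u)%E.
Proof.
move=> [N _ cu]; rewrite limn_einf_lim; apply: lime_ge; first exact: is_cvg_einfs.
exists N => // n /= Nn; apply: le_ereal_inf_tmp => _ [k /= nk <-].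
by apply: cu => /=; exact: leq_trans nk.
Qed.

(* [e] is summable in modular, so [\sum_n Phi (e n)] is integrable and dominates
   [Phi (sup_n e n / 2)]. *)
Lemma summable_modular_dominated (e : nat -> T -> R) :
  (forall n, measurable_fun setT (e n)) -> (forall n x, 0 <= e n x) ->
  (forall n, (modular P Phi (e n) 1 <= (1 / (2 ^ n.+1)%:R)%:E)%E) ->
  exists M : T -> R, [/\ LOrlicz P Phi M,
    {ae P, forall x, (fun n => e n x) @ \oo --> (0 : R)} &
    {ae P, forall x, forall n, e n x <= M x}].
Proof.
move=> me e0 eP; have [Phi0 _ _ _ _] := orlPhi.
pose phi n x : \bar R := (Phi (e n x))%:E.
have phi0 n x : (0 <= phi n x)%E by rewrite lee_fin (orlicz_ge0 orlPhi).
have phiE n : phi n = fun x => (Phi (`|e n x| / 1))%:E.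
  by apply/funext => x; rewrite /phi divr1 ger0_norm.
have mphi n : measurable_fun setT (phi n) by rewrite phiE; exact: measurable_orlicz.
pose S x : \bar R := (\sum_(0 <= n <oo) phi n x)%E.
have S0 x : (0 <= S x)%E by apply: nneseries_ge0 => n _ _.
have mS : measurable_fun setT S by apply: ge0_emeasurable_sum => // n x _ _.
have IS : (\int[P]_x S x < +oo)%E.
  rewrite /S integral_nneseries//.
  apply: (@le_lt_trans _ _ (\sum_(0 <= n <oo) (1 / (2 ^ n.+1)%:R)%:E)%E).
    apply: lee_nneseries => [n _ _|n _]; first exact: integral_ge0.
    by have := eP n; rewrite /modular phiE.
  by apply: (@le_lt_trans _ _ 1%:E); [exact: epsilon_trick0|exact: ltry].
have iS : P.-integrable setT S.
  apply/integrableP; split => //; rewrite (eq_integral S)// => x _.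
  by rewrite gee0_abs.
have Sfin : {ae P, forall x, (S x < +oo)%E}.
  by apply: filterS (integrable_ae measurableT iS) => x /(_ I); rewrite ge0_fin_numE.
have phiS n x : (phi n x <= S x)%E.
  apply: le_trans (nneseries_lim_ge n.+1 _); last by [].
  by rewrite big_nat_recr//= leeDr// sume_ge0.
pose m x := ereal_sup (range (fun n => (e n x)%:E)).
have em n x : ((e n x)%:E <= m x)%E by apply: ereal_sup_ubound; exists n.
have m0 x : (0 <= m x)%E by apply: le_trans (em 0%N x); rewrite lee_fin.
have mm : measurable_fun setT m.
  have := @measurable_fun_esups _ _ _ setT (fun n x => (e n x)%:E) (fun n => (measurable_EFinP _ _).2 (me n)) 0%N.
  congr measurable_fun; apply/funext => x; rewrite /m /esups/=; congr ereal_sup.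
  by apply/seteqP; split => _ [k _ <-]; exists k.
have mfin x : (S x < +oo)%E -> m x \is a fin_num.
  move=> Sx; rewrite ge0_fin_numE//.
  have SxE : S x = (fine (S x))%:E by rewrite fineK// ge0_fin_numE.
  have P10 : 0 < Phi 1 by exact: (orlicz_gt0 orlPhi).
  (* A value [e n x] above [1] is at most [Phi (e n x) / Phi 1] by convexity, hence at most
     [S x / Phi 1]. *)
  pose c := 1 + fine (S x) / Phi 1.
  apply: (@le_lt_trans _ _ c%:E); last exact: ltry.
  apply: ge_ereal_sup => _ [n _ <-]; rewrite lee_fin leNgt; apply/negP => cn.
  have s0 : 0 <= fine (S x) / Phi 1 by rewrite divr_ge0 ?fine_ge0// ltW.
  have en1 : 1 <= e n x by rewrite (le_trans _ (ltW cn))// lerDl.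
  have en0 : 0 < e n x by exact: lt_le_trans en1.
  have := @orlicz_scale _ _ orlPhi (e n x)^-1 (e n x) (e0 n x).
  rewrite mulVf ?gt_eqF// invr_ge0 invf_le1// => /(_ (e0 n x) en1).
  rewrite mulrC ler_pdivlMr// mulrC -ler_pdivlMr//.
  have := phiS n x; rewrite SxE lee_fin => h h'.
  have : e n x <= fine (S x) / Phi 1 by apply: (le_trans h'); rewrite ler_pM2r ?invr_gt0.
  by move: cn; rewrite /c; lra.
exists (fun x => fine (m x)); split.
- have mfm : measurable_fun setT (fun x => fine (m x)) by exact: measurableT_comp.
  apply: (@modular_LOrlicz _ _ _ _ _ orlPhi _ 2) => //.
  apply: le_lt_trans IS; apply: ae_ge0_le_integral => //.
  + by move=> x _; rewrite lee_fin (orlicz_ge0 orlPhi)// divr_ge0.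
  + exact: measurable_orlicz.
  apply: filterS Sfin => x Sx _; have mx := mfin x Sx.
  rewrite ger0_norm ?fine_ge0//.
  have := fine_ge0 (m0 x); rewrite le_eqVlt => /predU1P[<-|f0]; first by rewrite mul0r Phi0.
  (* The supremum need not be attained, but some [e n x] exceeds half of it; this is where the scale
     2 comes from. *)
  have : ((fine (m x) / 2)%:E < m x)%E by rewrite -[ltRHS]fineK// lte_fin; lra.
  move=> /ereal_sup_gt[_ [n _ <-]]; rewrite lte_fin => /ltW mn.
  apply: le_trans (phiS n x); rewrite lee_fin; apply: (orlicz_homo orlPhi) => //.
  by rewrite divr_ge0// ltW.
- apply: filterS Sfin => x Sx.
  apply/cvgr0Pnorm_lt => eps eps0.
  have Peps : (0 < (Phi eps)%:E)%E by rewrite lte_fin (orlicz_gt0 orlPhi).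
  (* Once the tail of the series is below [Phi eps], each later term is too, and monotonicity of
     [Phi] forces [e n x < eps]. *)
  have := @nneseries_tail_cvg _ (phi^~ x) xpredT Sx (fun k _ => phi0 k x).
  move=> /(_ _ (open_ereal_lt' Peps)) [N _ NP]; exists N => // n Nn.
  rewrite ger0_norm// ltNge; apply/negP => epsn.
  have := NP n Nn => /=; apply/negP; rewrite -leNgt.
  apply: (@le_trans _ _ (phi n x)); first by rewrite lee_fin (orlicz_homo orlPhi)// ltW.
  apply: le_trans (nneseries_lim_ge n.+1 _) => //.
  by rewrite big_nat1.
apply: filterS Sfin => x Sx n.
by rewrite -lee_fin fineK ?mfin.
Qed.

Lemma fatou_modular_closed (rho : (T -> R) -> \bar R) (c : \bar R) : fatou_property P Phi rho ->
  forall X (l : R), LOrlicz P Phi X -> 0 < l ->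
  (forall e : R, 0 < e -> exists2 X', LOrlicz P Phi X' /\ (rho X' <= c)%E &
    (modular P Phi (X' \- X)%R l <= e%:E)%E) -> (rho X <= c)%E.
Proof.
move=> fat X l LX l0 approx; have mX := LOrlicz_measurable LX.
have /choice[Xn XnP] : forall n : nat, exists X', [/\ LOrlicz P Phi X', (rho X' <= c)%E &
    (modular P Phi (X' \- X)%R l <= (1 / (2 ^ n.+1)%:R)%:E)%E].
  move=> n; have [|X' [LX' X'c] X'X] := approx (1 / (2 ^ n.+1)%:R).
    by rewrite divr_gt0// ltr0n expn_gt0.
  by exists X'.
have LXn n : LOrlicz P Phi (Xn n) by case: (XnP n).
pose e n x := `|Xn n x - X x| / l.
have me n : measurable_fun setT (e n).
  apply: measurable_funM => //; apply: measurableT_comp => //.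
  by apply: measurable_funB => //; exact: LOrlicz_measurable (LXn n).
have e0 n x : 0 <= e n x by rewrite divr_ge0// ltW.
have [|M [LM e_cvg eM]] := summable_modular_dominated me e0.
  move=> n; case: (XnP n) => _ _; congr (_ <= _)%E.
  by apply: eq_integral => x _; rewrite [`|e n x|]ger0_norm// divr1.
pose Y x := `|X x| + l * M x.
have LY : LOrlicz P Phi Y.
  apply: (LOrliczD orlPhi); last exact: (LOrliczZ orlPhi).
  apply: (le_LOrlicz orlPhi _ LX); first exact: measurableT_comp.
  by apply: aeW => x; rewrite normr_id.
have eE n x : `|Xn n x - X x| = l * e n x by rewrite mulrC divfK// gt_eqF.
apply: (@le_trans _ _ (limn_einf (fun n => rho (Xn n)))); last first.
  by apply: limn_einf_le => n; case: (XnP n).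
apply: (fat _ _ Y) => //.
  apply: filterS e_cvg => x ex; apply/cvgrPdist_lt => eps eps0.
  have epsl : 0 < eps / l by rewrite divr_gt0.
  have /cvgr0Pnorm_lt/(_ _ epsl) := ex; apply: filterS => n.
  by rewrite ger0_norm// ltr_pdivlMr// distrC eE mulrC.
move=> n; apply: filterS eM => x /(_ n) ex.
rewrite /Y -[Xn n x](subrK (X x)) addrC (le_trans (ler_normD _ _))// lerD2l eE.
by rewrite ler_pM2l.
Qed.

End FatouClosed.

(** * The conjugate function and Young's inequality *)

Section Conjugate.
Context {d : measure_display} {T : measurableType d} {R : realType}.
Variables (P : probability T R) (Phi : R -> R).
Hypothesis orlPhi : orlicz_function Phi.
Let Psi := conjugate Phi.

(** Beyond some [t0] superlinear growth gives [t * s <= Phi t]; below [t0] the expression is at most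
    [|s| * t0]. Thus the real-valued [sup] in [conjugate] is a true supremum. *)
Lemma conjugate_has_sup s : has_sup [set t * s - Phi t | t in [set t : R | 0 <= t]].
Proof.
split; first by exists (0 * s - Phi 0), 0 => //=.
have [_ _ _ _ /cvgryPge/(_ s)[M [_ MP]]] := orlPhi.
pose t0 := Num.max 1 (M + 1).
have t01 : 1 <= t0 by rewrite le_max lexx.
exists (`|s| * t0) => _ [t /= tp <-].
have s0 : 0 <= `|s| * t0 by rewrite mulr_ge0// (le_trans _ t01).
have [tt0|tt0] := leP t t0.
  have : t * s <= `|s| * t0.
    by rewrite (le_trans (ler_norm _))// normrM (ger0_norm tp) mulrC ler_wpM2l.
  by have := orlicz_ge0 orlPhi tp; lra.
have tpos : 0 < t by rewrite (lt_trans _ tt0)// (lt_le_trans _ t01).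
have /MP : M < t by rewrite (lt_trans _ tt0)// lt_max ltrDl ltr01 orbT.
by rewrite ler_pdivlMr// mulrC; lra.
Qed.

Lemma conjugate_ub s t : 0 <= t -> t * s - Phi t <= Psi s.
Proof. by move=> t0; apply: ub_le_sup; [case: (conjugate_has_sup s)|exists t]. Qed.

Lemma conjugate_le s c : (forall t, 0 <= t -> t * s - Phi t <= c) -> Psi s <= c.
Proof.
by move=> h; apply: ge_sup; [case: (conjugate_has_sup s)|move=> _ [t t0 <-]; exact: h].
Qed.

Lemma conjugate_ge0 s : 0 <= Psi s.
Proof.
have [Phi0 _ _ _ _] := orlPhi.
by have := conjugate_ub s (lexx 0); rewrite mul0r Phi0 subr0.
Qed.

Lemma conjugate_homo s t : s <= t -> Psi s <= Psi t.
Proof.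
move=> st; apply: conjugate_le => u u0; apply: le_trans (conjugate_ub t u0).
by rewrite lerD2r ler_wpM2l.
Qed.

Lemma conjugate_scale c s : 0 <= c -> c <= 1 -> Psi (c * s) <= c * Psi s.
Proof.
move=> c0 c1; apply: conjugate_le => t t0.
apply: (@le_trans _ _ (c * (t * s - Phi t))); last by rewrite ler_wpM2l// conjugate_ub.
rewrite mulrBr mulrCA lerD2l lerN2 ler_piMl// (orlicz_ge0 orlPhi)//.
Qed.

Lemma measurable_conjugate (Y : T -> R) (k : R) : measurable_fun setT Y ->
  measurable_fun setT (EFin \o (fun x => Psi (`|Y x| / k))).
Proof.
move=> mY; apply/measurable_EFinP; apply: (measurableT_comp (f := Psi)).
  by apply: nondecreasing_measurable => // s t; exact: conjugate_homo.
by apply: measurable_funM => //; exact: measurableT_comp.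
Qed.

Lemma Linfty_sub_HOrlicz : Linfty P `<=` HOrlicz P Psi.
Proof.
move=> Y [mY [M YM]].
have bound l : 0 < l -> (modular P Psi Y l <= (Psi (M / l))%:E)%E.
  move=> l0; apply: (@le_trans _ _ (\int[P]_x (cst (Psi (M / l))%:E x))%E); last first.
    rewrite integral_cst//; apply: (@le_trans _ _ ((Psi (M / l))%:E * 1)%E); last by rewrite mule1.
    by apply: lee_wpmul2l; [rewrite lee_fin conjugate_ge0|exact: probability_le1].
  apply: ae_ge0_le_integral => //.
  - by move=> x _; rewrite lee_fin conjugate_ge0.
  - exact: measurable_conjugate.
  - by move=> x _; rewrite lee_fin conjugate_ge0.
  apply: filterS YM => x YM _; rewrite lee_fin conjugate_homo//.
  by rewrite ler_pM2r ?invr_gt0.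
split; last by move=> l l0; apply: (le_lt_trans (bound l l0)); exact: ltry.
(* By [conjugate_scale], [Psi (M / l) <= Psi M / l <= 1] for this [l]. *)
split => //; pose l := 1 + Psi M.
have l1 : 1 <= l by rewrite lerDl conjugate_ge0.
have l0 : 0 < l by exact: lt_le_trans l1.
exists l; split => //; apply: (le_trans (bound l l0)).
rewrite lee_fin mulrC (le_trans (conjugate_scale _ _ _)) ?invr_ge0 ?(ltW l0) ?invf_le1//.
by rewrite mulrC ler_pdivrMr// mul1r lerDr.
Qed.

Lemma young_integrable X Y : LOrlicz P Phi X -> LOrlicz P Psi Y ->
  P.-integrable setT (EFin \o (fun x => X x * Y x)).
Proof.
move=> [mX [l [l0 Xl]]] [mY [k [k0 Yk]]].
have iX := modular_integrable orlPhi l0 mX (le_lt_trans Xl (ltry 1)).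
have iY : P.-integrable setT (EFin \o (fun x => Psi (`|Y x| / k))).
  apply/integrableP; split; first exact: measurable_conjugate.
  rewrite (eq_integral (fun x => (Psi (`|Y x| / k))%:E)).
    exact: le_lt_trans Yk (ltry 1).
  by move=> x _; rewrite gee0_abs// lee_fin conjugate_ge0.
apply: (@le_integrable _ _ _ P _ measurableT _
  (fun x => ((l * k)%:E * ((Phi (`|X x| / l))%:E + (Psi (`|Y x| / k))%:E))%E)).
- by apply/measurable_EFinP; exact: measurable_funM.
- move=> x _; rewrite -EFinD -EFinM /= lee_fin.
  have Xl0 : 0 <= `|X x| / l by rewrite divr_ge0// ltW.
  have P0 : 0 <= Phi (`|X x| / l) by exact: (orlicz_ge0 orlPhi).
  rewrite [leRHS]ger0_norm; last first.
    by rewrite mulr_ge0 ?addr_ge0 ?conjugate_ge0// mulr_ge0 ?ltW.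
  rewrite normrM.
  have -> : `|X x| * `|Y x| = l * k * ((`|X x| / l) * (`|Y x| / k)).
    by field; rewrite !gt_eqF.
  rewrite ler_pM2l ?mulr_gt0//.
  by have := conjugate_ub (`|Y x| / k) Xl0; lra.
- by apply: integrableZl => //; exact: integrableD.
Qed.

End Conjugate.

(** * The equivalence *)

Section Equivalence.
Context {d : measure_display} {T : measurableType d} {R : realType}.
Variables (P : probability T R) (Phi : R -> R).
Hypothesis orlPhi : orlicz_function Phi.
Let Psi := conjugate Phi.

Lemma weak_lsc_sub (E F : set (T -> R)) rho : E `<=` F -> weak_lsc P Phi E rho ->
  weak_lsc P Phi F rho.
Proof.
move=> EF lsc X LX l lX; have [n [Ys [eps [e0 YsE h]]]] := lsc X LX l lX.
by exists n, Ys, eps; split => // i /YsE/EF.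
Qed.

Lemma pairing_cvg (Xn : nat -> T -> R) (X Y W : T -> R) :
  (forall n, LOrlicz P Phi (Xn n)) -> LOrlicz P Phi X -> LOrlicz P Phi Y ->
  LOrlicz P Psi W ->
  {ae P, forall x, (fun n => Xn n x) @ \oo --> X x} ->
  (forall n, {ae P, forall x, `|Xn n x| <= Y x}) ->
  pairing P (Xn n \- X) W @[n --> \oo] --> 0.
Proof.
move=> LXn LX LY LW XnX XnY; have mW : measurable_fun setT W by case: LW.
have Labs Z : LOrlicz P Phi Z -> LOrlicz P Phi (fun x => `|Z x|).
  move=> LZ; apply: (le_LOrlicz orlPhi _ LZ).
    by apply: measurableT_comp => //; exact: LOrlicz_measurable LZ.
  by apply: aeW => x; rewrite normr_id.
have iG := young_integrable orlPhi (LOrliczD orlPhi (Labs _ LY) (Labs _ LX)) LW.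
have [||||_ _ cv] := @dominated_convergence _ _ _ P setT measurableT
  (fun n x => ((Xn n x - X x) * W x)%:E) (cst 0%E)
  (fun x => `|((`|Y x| + `|X x|) * W x)%:E|)%E _ _ _ (integrable_abse iG).
- move=> n; apply/measurable_EFinP; apply: measurable_funM => //.
  by apply: measurable_funB; [exact: LOrlicz_measurable (LXn n)|exact: LOrlicz_measurable LX].
- exact: measurable_cst.
- apply: filterS XnX => x Xx _.
  have XW : (Xn n x - X x) * W x @[n --> \oo] --> (0 : R).
    rewrite -(mul0r (W x)); apply: cvgMr_tmp.
    by rewrite -(subrr (X x)); apply: cvgB => //; exact: cvg_cst.
  have finXW : \forall n \near \oo, ((Xn n x - X x) * W x)%:E \is a fin_num by exact: nearW.
  exact: cvg_EFin finXW XW.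
- have : {ae P, forall x n, `|Xn n x| <= Y x} by exact: ae_foralln.
  apply: filterS => x XY n _; rewrite /= lee_fin !normrM ler_wpM2r//.
  rewrite [leRHS]ger0_norm ?addr_ge0// (le_trans (ler_normB _ _))// lerD2r.
  by rewrite (le_trans (XY n))// ler_norm.
rewrite integral_cst// mul0e in cv.
exact: (fine_cvg cv).
Qed.

Lemma weak_lsc_fatou rho : weak_lsc P Phi (LOrlicz P Psi) rho -> fatou_property P Phi rho.
Proof.
move=> lsc Xn X Y LXn LX LY XnX XnY.
have key (l : R) : (l%:E < rho X)%E -> (l%:E <= limn_einf (fun n => rho (Xn n)))%E.
  move=> /(lsc X LX)[n [Ys [eps [e0 YsE h]]]]; apply: le_limn_einf.
  (* A basic neighbourhood has finitely many test functions, so convergence of each pairing puts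
     [Xn k] in it for all large [k]. *)
  have : \forall k \near \oo, forall i : 'I_n, `|pairing P (Xn k \- X) (Ys i)| < eps.
    apply: filter_forall => i.
    have cv := pairing_cvg LXn LX LY (YsE i (ltn_ord i)) XnX XnY.
    by move/cvgr0Pnorm_lt : cv; exact.
  apply: filterS => k hk; apply/ltW/h => // i ni.
  exact: (hk (Ordinal ni)).
(* If [L] were below [rho X], a real level below [rho X] and above [L] would contradict [key]; the
   four cases choose it according to which of the two is infinite. *)
rewrite leNgt; apply/negP; set L := limn_einf _ in key * => LX'.
case: L (rho X) LX' key => [y| |] [x| |]// yx key.
- have := key ((x + y) / 2); rewrite lte_fin lee_fin; rewrite lte_fin in yx.
  have h1 : (x + y) / 2 < x by lra.
  by move=> /(_ h1); lra.
- by have := key (y + 1) (ltry _); rewrite lee_fin; lra.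
- have := key (x - 1); rewrite lte_fin leeNy_eq gtrBl ltr01 => /(_ isT).
  by [].
- by have := key 0 (ltry _); rewrite leeNy_eq.
Qed.

Lemma pairing_indic (D : set T) (Z X : T -> R) : measurable D -> LOrlicz P Phi Z ->
  LOrlicz P Phi X ->
  pairing P (Z \- X) \1_D = \int[P]_(x in D) Z x - \int[P]_(x in D) X x.
Proof.
move=> mD LZ LX; rewrite -RintegralB//; last 2 first.
- by apply: integrableS (LOrlicz_integrable orlPhi LZ).
- by apply: integrableS (LOrlicz_integrable orlPhi LX).
rewrite [RHS]Rintegral_mkcond; apply: eq_Rintegral => x _.
by rewrite /patch indicE; case: ifP => _; rewrite ?mulr1 ?mulr0.
Qed.

Lemma fatou_weak_lsc rho : nonatomic P -> quasiconvex_on (LOrlicz P Phi) rho ->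
  law_invariant_on P (LOrlicz P Phi) rho -> fatou_property P Phi rho ->
  weak_lsc P Phi (Linfty P) rho.
Proof.
move=> naP qc li fat X LX l lX; apply: contrapT => nbhs_fail.
suff : (rho X <= l%:E)%E by rewrite leNgt lX.
pose C := [set Z : T -> R | LOrlicz P Phi Z /\ (rho Z <= l%:E)%E].
suff : C X by case.
apply: (@closed_weak_approx _ _ _ _ _ orlPhi naP C) => //.
- by move=> Z [].
- move=> Z1 Z2 t [LZ1 Z1l] [LZ2 Z2l] t0 t1; split.
    by apply: (LOrliczD orlPhi); exact: (LOrliczZ orlPhi).
  by apply: le_trans (qc _ _ _ LZ1 LZ2 t0 t1) _; rewrite ge_max Z1l.
- by move=> Z1 Z2 [LZ1 Z1l] LZ2 Z12; split => //; rewrite (li _ _ LZ2 LZ1 Z12).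
- move=> Z k LZ k0 Zk; split => //; exact: (fatou_modular_closed orlPhi fat LZ k0).
(* If no element of [C] matched the integrals of [X] over the first [N] cells within [e], the
   indicators of these cells with radius [e] would define a neighbourhood of [X] on which [rho]
   exceeds [l]. *)
move=> N kappa e mk e0; apply: contrapT => noZ; apply: nbhs_fail.
exists N, (fun i => \1_(kappa @^-1` [set i])), e; split => //.
  move=> i _; split; first exact: measurable_indic.
  exists 1; apply: aeW => x; rewrite indicE.
  by case: (_ \in _); rewrite ?normr1 ?normr0.
move=> Z LZ Zpair; rewrite ltNge; apply/negP => Zl; apply: noZ; exists Z => // i iN.
by rewrite -pairing_indic//; exact: Zpair.
Qed.

End Equivalence.


Theorem theorem1 (d : measure_display) (T : measurableType d) (R : realType)
  (P : probability T R) (Phi : R -> R) (rho : (T -> R) -> \bar R) :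
  nonatomic P ->
  orlicz_function Phi ->
  (forall X, LOrlicz P Phi X -> rho X != -oo%E) ->
  proper_on (LOrlicz P Phi) rho ->
  quasiconvex_on (LOrlicz P Phi) rho ->
  law_invariant_on P (LOrlicz P Phi) rho ->
  let Psi := conjugate Phi in
  [/\ weak_lsc P Phi (Linfty P) rho <-> weak_lsc P Phi (HOrlicz P Psi) rho,
      weak_lsc P Phi (HOrlicz P Psi) rho <-> weak_lsc P Phi (LOrlicz P Psi) rho
    & weak_lsc P Phi (LOrlicz P Psi) rho <-> fatou_property P Phi rho].
Proof.
move=> naP orlPhi _ _ qc li Psi.
have LinfH := @Linfty_sub_HOrlicz _ _ _ P _ orlPhi.
have HL : HOrlicz P Psi `<=` LOrlicz P Psi by move=> Y [].
have i12 := weak_lsc_sub (rho := rho) LinfH.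
have i23 := weak_lsc_sub (rho := rho) HL.
have i34 := weak_lsc_fatou (rho := rho) orlPhi.
have i41 := fatou_weak_lsc orlPhi naP qc li.
by split; split => h; auto.
Qed.
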